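(* The Banach space $X_u=T\left[\left(\mathcal{M}_j,\frac{1}{m_j}\right)_{j=0}^{\infty}\right]$ is arbitrarily distortable.
   Context: Notation. For finite sets $E,F\subset\mathbb{N}$ and $n\in\mathbb{N}$: $E<F$ means $\max E<\min F$; $n\le E$ means $n\le\min E$; $E<n$ means $\max E<n$; $E\le n$ means $\max E\le n$. $c_{00}$ is the space of finitely supported real sequences, with unit vectors $e_n$; $\mathrm{supp}\,x$ is the support of $x$; for $E\subset\mathbb{N}$, $Ex$ is the restriction of $x$ to $E$ (zero off $E$). Families. The Schreier family is $\mathcal{S}=\{F\subset\mathbb{N}: F \text{ finite}, \#F\le\min F\}$. For families $\mathcal{M},\mathcal{N}$ of finite subsets of $\mathbb{N}$, $\mathcal{M}[\mathcal{N}]$ is the family of all $F=\bigcup_{i=1}^sF_i$ with $F_i\in\mathcal{N}$ and $m_1\le F_1<m_2\le F_2<\dots<m_s\le F_s$ for some $\{m_1,\dots,m_s\}\in\mathcal{M}$. Put $\mathcal{F}_0=\{\{n\}:n\in\mathbb{N}\}$ and $\mathcal{F}_{n+1}=\mathcal{S}[\mathcal{F}_n]$. A finite sequence $E_1,\dots,E_n$ of finite subsets of $\mathbb{N}$ is $\mathcal{M}$-admissible if there is $\{k_1,\dots,k_n\}\in\mathcal{M}$ with $k_1\le E_1<k_2\le E_2<\dots<k_n\le E_n$. Tsirelson type norms. For $0<\theta_k<1$ and families $\mathcal{M}_k$ closed in the topology of pointwise convergence (sets identified with indicator functions), $T[(\mathcal{M}_k,\theta_k)_k]$ is the completion of $c_{00}$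 under the norm defined implicitly by $\|x\|=\max\{\|x\|_\infty,\sup_k\theta_k\sup\sum_{i=1}^n\|E_ix\|\}$, the inner sup over all $n$ and all $\mathcal{M}_k$-admissible $E_1,\dots,E_n$. $|\cdot|_n$ denotes the norm of $T[\mathcal{F}_n,\frac12]$ (single family $\mathcal{F}_n$, $\theta=\frac12$). Choice of $(m_j)$ and $(\mathcal{M}_j)$. Fix integers $m_0=2$, $m_j>m_{j-1}^{m_{j-1}}$ for $j\ge1$. Put $\mathcal{M}_0=\mathcal{F}_1$. Inductively, given $\mathcal{M}_0,\dots,\mathcal{M}_n$, increasing and with integers $k_j$ such that $\mathcal{M}_j\subset\mathcal{F}_{k_j}$ for $j\le n$ (and $\mathcal{F}_{k_j}\subset\mathcal{M}_{j+1}$ for $j<n$), choose $s_{n+1}>k_n$ such that for every infinite $D\subset\mathbb{N}$ there is a convex combination $x=\sum_{i=1}^sa_ie_{r_i}$ ($r_1<\dots<r_s$) with $\mathrm{supp}\,x\subset D$, $\mathrm{supp}\,x\in\mathcal{F}_{s_{n+1}}$, $(a_i)$ decreasing and $|x|_{k_n}<\frac{1}{m_{n+2}^4}$; choose $l_{n+1}$ with $\frac{1}{2^{l_{n+1}}}<\frac{1}{2m_{n+1}}$; set $\mathcal{M}_{n+1}=\mathcal{F}_{s_{n+1}}[\cdots[\mathcal{F}_{s_{n+1}}]\cdots]$ ($l_{n+1}$ times). This keeps $\mathcal{M}_j\subset\mathcal{F}_{k_j}\subset\mathcal{M}_{j+1}$ for suitable $k_j$. A Banach space $(Y,\|\cdot\|)$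 is arbitrarily distortable if for every $\lambda>1$ there is an equivalent norm $|\cdot|$ on $Y$ such that for every infinite-dimensional closed subspace $Z\subset Y$, $\sup\{|x|/|y|: x,y\in Z,\ \|x\|=\|y\|=1\}\ge\lambda$. *)

(* Defs.v *)
From HB Require Import structures.
From mathcomp Require Import all_boot all_order all_algebra finmap.
From mathcomp Require Import all_classical all_reals all_analysis.

Set Implicit Arguments.
Unset Strict Implicit.
Unset Printing Implicit Defensive.

Import Order.TTheory GRing.Theory Num.Theory.
Import numFieldNormedType.Exports.

Local Open Scope classical_set_scope.
Local Open Scope ring_scope.

(* The index set is {1, 2, ...}, as a part of nat: no vector has a nonzero
   coordinate at 0, and no set of one of the families below contains 0. *)

Definition c00_pred (R : realType) : {pred nat -> R} :=
  [pred x : nat -> R | `[< x 0%N = 0 /\ finite_set [set n | x n != 0] >]].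
Arguments c00_pred R : clear implicits.

Record c00 (R : realType) := C00 {
  c00_val :> nat -> R ;
  _ : c00_val \in c00_pred R
}.

HB.instance Definition _ (R : realType) := [isSub for (@c00_val R)].
HB.instance Definition _ (R : realType) := [Choice of c00 R by <:].

Lemma c00_submod_closed (R : realType) : submod_closed (c00_pred R).
Proof.
split=> [|a x y /asboolP[x0 xf] /asboolP[y0 yf]]; apply/asboolP; split=> //.
- by apply: (sub_finite_set _ (finite_set0 nat)) => n /=; rewrite eqxx.
- by change (a * x 0%N + y 0%N = 0); rewrite x0 y0 mulr0 addr0.
- apply: (@sub_finite_set _ _ ([set n | x n != 0] `|` [set n | y n != 0])).
    move=> n /=; have [xn|] := eqVneq (x n) 0; last by left.
    have [yn|] := eqVneq (y n) 0; last by right.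
    by have -> : (a *: x + y) n = a * x n + y n by []; rewrite xn yn mulr0 addr0 eqxx.
  by rewrite finite_setU.
Qed.

HB.instance Definition _ (R : realType) :=
  GRing.isSubmodClosed.Build _ _ (c00_pred R) (c00_submod_closed R).
HB.instance Definition _ (R : realType) :=
  [SubChoice_isSubLmodule of c00 R by <:].

Lemma c00P (R : realType) (x : c00 R) : x 0%N = 0.
Proof. by have /asboolP[] := valP x. Qed.

Lemma c00_finite (R : realType) (x : c00 R) : finite_set [set n | x n != 0].
Proof. by have /asboolP[] := valP x. Qed.

Definition c00_supp (R : realType) (x : c00 R) : {fset nat} :=
  fset_set [set n | x n != 0].

Lemma mem_c00_supp (R : realType) (x : c00 R) n : (n \in c00_supp x) = (x n != 0).
Proof. by rewrite in_fset_set ?in_setE//; [apply/asboolP/idP|exact: c00_finite]. Qed.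

(* The unit vector e_n for n >= 1; the junk value e_0 is 0. *)
Definition c00_unit_fun (R : realType) (n : nat) : nat -> R :=
  fun i => ((0 < n)%N && (i == n))%:R.

Lemma c00_unit_subproof (R : realType) (n : nat) :
  c00_unit_fun R n \in c00_pred R.
Proof.
apply/asboolP; split; first by rewrite /c00_unit_fun; case: n.
apply: (sub_finite_set _ (finite_set1 n)) => i /=.
by rewrite /c00_unit_fun; case: (i =P n) => [->//|_]; rewrite andbF eqxx.
Qed.

Definition c00_unit (R : realType) (n : nat) : c00 R :=
  C00 (c00_unit_subproof R n).

Definition restr_fun (R : realType) (E : {fset nat}) (x : c00 R) : nat -> R :=
  fun n => if n \in E then x n else 0.

Lemma restr_subproof (R : realType) (E : {fset nat}) (x : c00 R) :
  restr_fun E x \in c00_pred R.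
Proof.
apply/asboolP; split; first by rewrite /restr_fun c00P; case: ifP.
apply: (sub_finite_set _ (c00_finite x)) => n /=.
by rewrite /restr_fun; case: ifP; rewrite ?eqxx.
Qed.

Definition restr (R : realType) (E : {fset nat}) (x : c00 R) : c00 R :=
  C00 (restr_subproof E x).

(* k_1 <= E_1 < k_2 <= E_2 < ... < k_s <= E_s; the sets are nonempty, so that
   the minima and maxima in these inequalities make sense. *)
Definition interlaced (s : nat) (k : 'I_s -> nat) (E : 'I_s -> {fset nat}) :=
  [/\ forall i, E i != fset0,
      forall i j, j \in E i -> (k i <= j)%N &
      forall i i' : 'I_s, i' = i.+1 :> nat ->
        forall j, j \in E i -> (j < k i')%N].

Definition admissible (M : set {fset nat}) (s : nat) (E : 'I_s -> {fset nat}) :=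
  exists k : 'I_s -> nat, M [fset k i | i : 'I_s]%fset /\ interlaced k E.

(* The empty set is a member: min F is only constrained when F is nonempty. *)
Definition schreier : set {fset nat} :=
  [set F | forall i, i \in F -> (#|` F| <= i)%N].

Definition family_prod (M N : set {fset nat}) : set {fset nat} :=
  [set F | exists s (E : 'I_s -> {fset nat}),
    [/\ forall i, N (E i), admissible M E &
        F = \big[@fsetU nat/fset0]_(i < s) E i]].

Fixpoint schreier_iter (n : nat) : set {fset nat} :=
  if n is n'.+1 then family_prod schreier (schreier_iter n')
  else [set F | exists2 i, (0 < i)%N & F = [fset i]%fset].

(* M[M[...[M]...]] with l occurrences of M, for l >= 1. *)
Definition family_power (M : set {fset nat}) (l : nat) : set {fset nat} :=
  iter l.-1 (family_prod M) M.

Definition is_norm (R : realType) (V : lmodType R) (p : V -> R) :=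
  [/\ forall x y, p (x + y) <= p x + p y,
      forall a x, p (a *: x) = `|a| * p x &
      forall x, p x = 0 -> x = 0].

Definition is_tsirelson_norm (R : realType) (K : Type)
    (M : K -> set {fset nat}) (theta : K -> R) (N : c00 R -> R) :=
  is_norm N /\
  forall x, ((N x)%:E =
    maxe (ereal_sup [set `|x n|%:E | n in [set: nat]])
         (ereal_sup [set (theta k)%:E *
            ereal_sup [set y | exists s (E : 'I_s -> {fset nat}),
              admissible (M k) E /\ y = (\sum_(i < s) N (restr (E i) x))%:E]
            | k in [set: K]]))%E.

(* The norm of T[(M_k, theta_k)_k] on c00, defined by its implicit equation;
   see tsirelson_normP and tsirelson_norm_unique for existence and uniqueness. *)
Definition tsirelson_norm (R : realType) (K : Type)
    (M : K -> set {fset nat}) (theta : K -> R) : c00 R -> R :=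
  xget (fun=> 0) [set N | is_tsirelson_norm M theta N].

Section TsirelsonNorm.
Variables (R : realType) (K : Type).
Variables (M : K -> set {fset nat}) (theta : K -> R).

Let c00_eq (x y : c00 R) : (forall n, x n = y n) -> x = y.
Proof. by move=> xy; apply/val_inj/funext. Qed.

Let restrE (E : {fset nat}) (x : c00 R) n :
  restr E x n = if n \in E then x n else 0.
Proof. by []. Qed.

Let restrD E (x y : c00 R) : restr E (x + y) = restr E x + restr E y.
Proof.
apply: c00_eq => n.
have -> : (restr E x + restr E y) n = restr E x n + restr E y n by [].
rewrite !restrE; have -> : (x + y) n = x n + y n by [].
by case: ifP; rewrite ?addr0.
Qed.

Let restrZ E a (x : c00 R) : restr E (a *: x) = a *: restr E x.
Proof.
apply: c00_eq => n.
have -> : (a *: restr E x) n = a * restr E x n by [].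
rewrite !restrE; have -> : (a *: x) n = a * x n by [].
by case: ifP; rewrite ?mulr0.
Qed.

Let values (N : c00 R -> R) (x : c00 R) : set R :=
  [set `|x n| | n in [set: nat]] `|`
  [set y | exists k s (E : 'I_s -> {fset nat}),
     admissible (M k) E /\ y = theta k * \sum_(i < s) N (restr (E i) x)].

Let values_neq0 N x : values N x !=set0.
Proof. by exists `|x 0%N|; left; exists 0%N. Qed.

Let valuesE (N : c00 R -> R) (x : c00 R) : (forall k, 0 < theta k) ->
  (maxe (ereal_sup [set `|x n|%:E | n in [set: nat]])
        (ereal_sup [set (theta k)%:E *
           ereal_sup [set y | exists s (E : 'I_s -> {fset nat}),
             admissible (M k) E /\ y = (\sum_(i < s) N (restr (E i) x))%:E]
           | k in [set: K]]) = ereal_sup [set y%:E | y in values N x])%E.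
Proof.
move=> theta_gt0; apply/eqP; rewrite eq_le; apply/andP; split.
- rewrite ge_max; apply/andP; split.
    apply: ge_ereal_sup => _ [n _ <-]; apply: ereal_sup_ubound.
    by exists `|x n| => //; left; exists n.
  apply: ge_ereal_sup => _ [k _ <-].
  rewrite -ereal_sup_pZl//; apply: ge_ereal_sup => _ [_ [s [E [ME ->]]] <-].
  apply: ereal_sup_ubound; exists (theta k * \sum_(i < s) N (restr (E i) x)).
    by right; exists k, s, E.
  by rewrite EFinM.
- apply: ge_ereal_sup => _ [_ [[n _ <-]|[k [s [E [ME ->]]]]] <-].
    by rewrite le_max ereal_sup_ubound//; exists n.
  rewrite le_max; apply/orP; right; apply: le_ereal_sup_tmp; eexists.
    by exists k.
  rewrite EFinM lee_pmul2l//; last by rewrite lte_fin.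
  by apply: ereal_sup_ubound; exists s, E.
Qed.

Let is_tsirelson_normP (N : c00 R -> R) : (forall k, 0 < theta k) ->
  is_tsirelson_norm M theta N <->
  is_norm N /\ forall x, ubound (values N x) (N x) /\ N x <= sup (values N x).
Proof.
move=> theta_gt0; split=> -[Nnorm NE]; split=> // x; have := NE x.
- rewrite valuesE// => NxE.
  have Nub : ubound (values N x) (N x).
    move=> y Ny; rewrite -lee_fin NxE; apply: ereal_sup_ubound.
    by exists y.
  split=> //; rewrite -lee_fin -ereal_sup_EFin ?NxE//; first by exists (N x).
- move=> [Nub Nle]; rewrite valuesE//.
  rewrite ereal_sup_EFin//; last by exists (N x).
  congr (_%:E); apply/eqP; rewrite eq_le Nle/=; exact: ge_sup.
Qed.

Let l1 (x : c00 R) : R := \sum_(n <- c00_supp x) `|x n|.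

Let l1_coord (x : c00 R) n : `|x n| <= l1 x.
Proof.
have [xn|xn] := eqVneq (x n) 0; first by rewrite xn normr0 sumr_ge0.
rewrite /l1 (big_fsetD1 n)/=; last by rewrite mem_c00_supp.
by rewrite lerDl sumr_ge0.
Qed.

Let l1_restr E (x : c00 R) :
  l1 (restr E x) = \sum_(n <- c00_supp x) if n \in E then `|x n| else 0.
Proof.
have sub : (c00_supp (restr E x) `<=` c00_supp x)%fset.
  apply/fsubsetP => n; rewrite !mem_c00_supp restrE.
  by case: ifP => //; rewrite eqxx.
rewrite /l1 (big_fset_incl _ sub); last first.
  by move=> n _; rewrite mem_c00_supp negbK => /eqP ->; rewrite normr0.
by apply: eq_bigr => n _; rewrite restrE; case: ifP => //; rewrite normr0.
Qed.

Let admissible_disj F s (E : 'I_s -> {fset nat}) :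
  admissible F E -> forall i j n, n \in E i -> n \in E j -> i = j.
Proof.
move=> [k [_ [E0 kE Ek]]].
have lt (d : nat) (i j : 'I_s) : (j = i + d.+1 :> nat)%N ->
    forall n, n \in E i -> (n < k j)%N.
  elim: d j => [|d IH] j ji n ni.
    by apply: (Ek i) => //; rewrite ji addnC.
  have ltd : (i + d.+1 < s)%N.
    by apply: leq_trans (ltn_ord j); rewrite ji !addnS.
  have /fset0Pn[p pE] := E0 (Ordinal ltd).
  apply: (@leq_ltn_trans p); last first.
    by apply: (Ek (Ordinal ltd)) => //=; rewrite ji addnS.
  apply: leq_trans (kE _ _ pE); exact/ltnW/IH.
have lt' (i j : 'I_s) n : (i < j)%N -> n \in E i -> n \in E j -> False.
  move=> ij ni /kE; rewrite leqNgt => /negP; apply.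
  by apply: (lt (j - i.+1)%N i) => //; rewrite addnS -addSn subnKC.
move=> i j n ni nj; apply/val_inj; case: (ltngtP i j) => // h.
  by case: (lt' i j n).
by case: (lt' j i n).
Qed.

Let l1_admissible F s (E : 'I_s -> {fset nat}) x : admissible F E ->
  \sum_(i < s) l1 (restr (E i) x) <= l1 x.
Proof.
move=> FE; under eq_bigr do rewrite l1_restr.
rewrite exchange_big/=; apply: ler_sum => n _.
case: (pickP (fun i => n \in E i)) => [i ni|nE]; last first.
  by rewrite big1// => i _; rewrite nE.
rewrite (bigD1 i)//= ni big1 ?addr0// => j ji; case: ifP => // nj.
by rewrite (admissible_disj FE nj ni) eqxx in ji.
Qed.

Section Existence.
Hypothesis theta_gt0 : forall k, 0 < theta k.
Hypothesis theta_le1 : forall k, theta k <= 1.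

Let values_ub N x : (forall x, N x <= l1 x) -> ubound (values N x) (l1 x).
Proof.
move=> Nl1 _ [[n _ <-]//|[k [s [E [ME ->]]]]].
rewrite -[l1 x]mul1r; apply: (@le_trans _ _ (theta k * l1 x)); last first.
  by rewrite ler_wpM2r// sumr_ge0.
rewrite ler_wpM2l ?(ltW (theta_gt0 k))//; apply: le_trans (l1_admissible x ME).
by apply: ler_sum => i _; exact: Nl1.
Qed.

Let sub_values N N' x : (forall x, N x <= N' x) -> (forall x, N' x <= l1 x) ->
  sup (values N x) <= sup (values N' x).
Proof.
move=> NN' N'l1.
have ub : has_ubound (values N' x) by exists (l1 x); exact: values_ub.
apply: ge_sup => // _ [[n _ <-]|[k [s [E [ME ->]]]]].
  by apply: ub_le_sup => //; left; exists n.
apply: (@le_trans _ _ (theta k * \sum_(i < s) N' (restr (E i) x))).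
  by rewrite ler_wpM2l ?(ltW (theta_gt0 k))//; apply: ler_sum => i _.
by apply: ub_le_sup => //; right; exists k, s, E.
Qed.

Let presol (f : c00 R -> R) :=
  [/\ forall x y, f (x + y) <= f x + f y,
      forall a x, f (a *: x) <= `|a| * f x,
      forall x, f x <= l1 x &
      forall x, f x <= sup (values f x)].

Let supnorm (x : c00 R) := sup [set `|x n| | n in [set: nat]].

Let supnorm_has (x : c00 R) : has_sup [set `|x n| | n in [set: nat]].
Proof.
split; first by exists `|x 0%N|, 0%N.
by exists (l1 x) => _ [n _ <-].
Qed.

Let presol_supnorm : presol supnorm.
Proof.
split.
- move=> x y; apply: ge_sup; first by case: (supnorm_has (x + y)).
  move=> _ [n _ <-]; apply: le_trans (ler_normD (x n) (y n)) _.
  by apply: lerD; apply: ub_le_sup; try exact: (supnorm_has _).2; exists n.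
- move=> a x; apply: ge_sup; first by case: (supnorm_has (a *: x)).
  move=> _ [n _ <-].
  have -> : (a *: x) n = a * x n by [].
  rewrite normrM ler_wpM2l//.
  by apply: ub_le_sup; [exact: (supnorm_has _).2|exists n].
- move=> x; apply: ge_sup; first by case: (supnorm_has x).
  by move=> _ [n _ <-].
- have snl1 x : supnorm x <= l1 x.
    apply: ge_sup; first by case: (supnorm_has x).
    by move=> _ [n _ <-].
  move=> x; apply: ge_sup; first by case: (supnorm_has x).
  move=> _ [n _ <-]; apply: ub_le_sup; last by left; exists n.
  by exists (l1 x); exact: values_ub.
Qed.

Let gfp (x : c00 R) := sup [set f x | f in presol].

Let gfp_ub f x : presol f -> f x <= gfp x.
Proof.
move=> fP; apply: ub_le_sup; last by exists f.
by exists (l1 x) => _ [g [_ _ + _] <-]; exact.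
Qed.

Let gfp_le x y : (forall f, presol f -> f x <= y) -> gfp x <= y.
Proof.
move=> h; apply: ge_sup; first by exists (supnorm x), supnorm.
by move=> _ [f fP <-]; exact: h.
Qed.

Let gfp_l1 x : gfp x <= l1 x.
Proof. by apply: gfp_le => f [_ _ + _]; exact. Qed.

Let gfp_presol : presol gfp.
Proof.
split=> //.
- move=> x y; apply: gfp_le => f fP; have [fD _ _ _] := fP.
  by apply: le_trans (fD x y) _; apply: lerD; exact: gfp_ub.
- move=> a x; apply: gfp_le => f fP; have [_ fZ _ _] := fP.
  by apply: le_trans (fZ a x) _; rewrite ler_wpM2l//; exact: gfp_ub.
- move=> x; apply: gfp_le => f fP; have [_ _ _ fv] := fP.
  by apply: le_trans (fv x) _; apply: sub_values => // y; exact: gfp_ub.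
Qed.

Let step (x : c00 R) := sup (values gfp x).

Let values_has_ub x : has_ubound (values gfp x).
Proof. by exists (l1 x); exact: values_ub. Qed.

Let step_presol : presol step.
Proof.
have [gD gZ _ gv] := gfp_presol.
have sl1 x : step x <= l1 x by apply: ge_sup => //; exact: values_ub.
split=> //.
- move=> x y; apply: ge_sup => // _ [[n _ <-]|[k [s [E [ME ->]]]]].
    apply: le_trans (ler_normD (x n) (y n)) _.
    by apply: lerD; apply: ub_le_sup => //; left; exists n.
  apply: (@le_trans _ _ (theta k * (\sum_(i < s) gfp (restr (E i) x) +
      \sum_(i < s) gfp (restr (E i) y)))).
    rewrite ler_wpM2l ?(ltW (theta_gt0 k))// -big_split/=; apply: ler_sum => i _.
    by rewrite restrD; exact: gD.
  by rewrite mulrDr; apply: lerD; apply: ub_le_sup => //; right; exists k, s, E.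
- move=> a x; apply: ge_sup => // _ [[n _ <-]|[k [s [E [ME ->]]]]].
    have -> : (a *: x) n = a * x n by [].
    by rewrite normrM ler_wpM2l//; apply: ub_le_sup => //; left; exists n.
  apply: (@le_trans _ _ (`|a| * (theta k * \sum_(i < s) gfp (restr (E i) x)))).
    rewrite mulrCA ler_wpM2l ?(ltW (theta_gt0 k))// mulr_sumr; apply: ler_sum => i _.
    by rewrite restrZ; exact: gZ.
  by rewrite ler_wpM2l//; apply: ub_le_sup => //; right; exists k, s, E.
- by move=> x; apply: sub_values.
Qed.

Lemma tsirelson_norm_exists : exists N : c00 R -> R, is_tsirelson_norm M theta N.
Proof.
exists gfp; apply/is_tsirelson_normP => //.
have [gD gZ _ gv] := gfp_presol.
have gub x : ubound (values gfp x) (gfp x).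
  move=> y gy; apply: le_trans (gfp_ub x step_presol).
  exact: ub_le_sup.
have gn (x : c00 R) n : `|x n| <= gfp x by apply: gub; left; exists n.
split; last by [].
split=> //.
- move=> a x; apply/eqP; rewrite eq_le gZ/=.
  have [->|a0] := eqVneq a 0.
    by rewrite normr0 mul0r; apply: le_trans (gn _ 0%N).
  rewrite mulrC -ler_pdivlMr ?normr_gt0// mulrC.
  by have := gZ a^-1 (a *: x); rewrite scalerA mulVf// scale1r normfV.
- move=> x gx0; apply: c00_eq => n; apply/eqP.
  by rewrite -normr_le0 -gx0.
Qed.

Lemma tsirelson_normP : is_tsirelson_norm M theta (tsirelson_norm M theta).
Proof. exact: xgetPex tsirelson_norm_exists. Qed.

End Existence.

Lemma tsirelson_norm_unique (c : R) (N N' : c00 R -> R) :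
  (forall k, 0 < theta k <= c) -> c < 1 ->
  is_tsirelson_norm M theta N -> is_tsirelson_norm M theta N' -> N = N'.
Proof.
move=> thetac c1.
have theta_gt0 k : 0 < theta k by case/andP: (thetac k).
move=> /is_tsirelson_normP => /(_ theta_gt0)[[_ ZN _] NE].
move=> /is_tsirelson_normP => /(_ theta_gt0)[[_ ZN' _] NE'].
suff le (P P' : c00 R -> R) : (forall a x, P (a *: x) = `|a| * P x) ->
    (forall x, ubound (values P x) (P x) /\ P x <= sup (values P x)) ->
    (forall x, ubound (values P' x) (P' x) /\ P' x <= sup (values P' x)) ->
    forall x, P x <= P' x.
  by apply/funext => x; apply/eqP; rewrite eq_le !le.
move=> {N N' ZN NE ZN' NE'} PZ PE P'E x.
have P0 : P 0 = 0 by have := PZ 0 0; rewrite scale0r normr0 mul0r.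
have [n] := ubnP #|` c00_supp x|; elim: n x => // n IH x; rewrite ltnS => xn.
have P'ge0 : 0 <= P' x.
  by apply: (@le_trans _ _ (`|x 0%N|)) => //; apply: (P'E x).1; left; exists 0%N.
have Pge0 : 0 <= P x.
  by apply: (@le_trans _ _ (`|x 0%N|)) => //; apply: (PE x).1; left; exists 0%N.
have : P x <= Num.max (P' x) (c * P x).
  apply: le_trans (PE x).2 _; apply: ge_sup => // _ [[i _ <-]|[k [s [E [ME ->]]]]].
    by rewrite le_max (P'E x).1//; left; exists i.
  have [i iE|nE] := pickP (fun i => c00_supp x `<=` E i)%fset.
    rewrite le_max; apply/orP; right.
    rewrite (bigD1 i)//= big1 => [|j ji]; last first.
      rewrite (_ : restr (E j) x = 0)//; apply: c00_eq => p.
      rewrite restrE; case: ifPn => // pj.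
      apply/eqP/negPn/negP; rewrite -mem_c00_supp => /(fsubsetP iE) pi.
      by rewrite (admissible_disj ME pj pi) eqxx in ji.
    rewrite addr0 (_ : restr (E i) x = x); last first.
      apply: c00_eq => p; rewrite restrE; case: ifPn => // pi.
      apply/esym/eqP/negPn/negP; rewrite -mem_c00_supp => /(fsubsetP iE).
      exact/negP.
    by rewrite ler_wpM2r//; case/andP: (thetac k).
  rewrite le_max; apply/orP; left.
  apply: (@le_trans _ _ (theta k * \sum_(i < s) P' (restr (E i) x))).
    rewrite ler_wpM2l ?(ltW (theta_gt0 k))//; apply: ler_sum => i _; apply: IH.
    apply: leq_trans xn; apply: fproper_ltn_card; rewrite fproperE; apply/andP; split.
      apply/fsubsetP => p; rewrite !mem_c00_supp restrE.
      by case: ifP => //; rewrite eqxx.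
    have /negbT/fsubsetPn[p px pi] := nE i; apply/negP => /fsubsetP/(_ p px).
    by rewrite mem_c00_supp restrE (negbTE pi) eqxx.
  by apply: (P'E x).1; right; exists k, s, E.
rewrite le_max => /orP[//|PcP].
suff -> : P x = 0 by [].
apply/eqP; rewrite eq_le Pge0 andbT.
have : (1 - c) * P x <= 0 by rewrite mulrBl mul1r subr_le0.
by rewrite pmulr_rle0// subr_gt0.
Qed.

End TsirelsonNorm.

(* X is (a model of) the completion T[(M_k, theta_k)_k]: c00 embeds into X
   linearly and isometrically, with dense range. *)
Definition is_tsirelson_space (R : realType) (K : Type)
    (M : K -> set {fset nat}) (theta : K -> R) (X : completeNormedModType R) :=
  exists iota : {linear c00 R -> X},
    (forall x, `|iota x| = tsirelson_norm M theta x) /\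
    dense (range iota).

(* The norm of T[F_n, 1/2]. *)
Definition half_norm (R : realType) (n : nat) : c00 R -> R :=
  tsirelson_norm (fun _ : unit => schreier_iter n) (fun _ => 2^-1).

Definition small_combinations (R : realType) (k s : nat) (eps : R) :=
  forall D : set nat, infinite_set D ->
  exists q (r : 'I_q -> nat) (a : 'I_q -> R),
    let x := \sum_(i < q) a i *: c00_unit R (r i) in
    [/\ (forall i, 0 < r i)%N,
        {homo r : i j / (i < j)%N},
        (forall i, 0 <= a i) /\ \sum_(i < q) a i = 1,
        {homo a : i j / (i <= j)%N >-> j <= i} &
        [/\ [set` c00_supp x] `<=` D,
            schreier_iter s (c00_supp x) &
            half_norm k x < eps]].

Definition mixed_family (s l : nat -> nat) (j : nat) : set {fset nat} :=
  if j is _.+1 then family_power (schreier_iter (s j)) (l j)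
  else schreier_iter 1.

Record admissible_choice (R : realType) (m k s l : nat -> nat) : Prop := {
  choice_m0 : m 0%N = 2%N;
  choice_mS : forall j, (m j ^ m j < m j.+1)%N;
  choice_sub_k : forall j, mixed_family s l j `<=` schreier_iter (k j);
  choice_k_sub : forall j, schreier_iter (k j) `<=` mixed_family s l j.+1;
  choice_s_gt : forall j, (k j < s j.+1)%N;
  choice_s : forall j,
    small_combinations (k j) (s j.+1) (((m j.+2)%:R : R) ^+ 4)^-1;
  choice_l : forall j, ((2 : R) ^+ l j.+1)^-1 < (2 * (m j.+1)%:R)^-1
}.

Definition infinite_dimensional (R : realType) (Y : lmodType R) (Z : set Y) :=
  ~ exists n (v : 'I_n -> Y), (forall i, Z (v i)) /\
      forall z, Z z -> exists a : 'I_n -> R, z = \sum_(i < n) a i *: v i.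

Definition equivalent_norm (R : realType) (Y : normedModType R) (p : Y -> R) :=
  is_norm p /\
  exists c C : R, [/\ 0 < c, 0 < C & forall y, c * `|y| <= p y <= C * `|y|].

Definition arbitrarily_distortable (R : realType)
    (Y : completeNormedModType R) :=
  forall lambda : R, 1 < lambda ->
  exists2 p : Y -> R, equivalent_norm p &
  forall Z : set Y, submod_closed [in Z] -> closed Z -> infinite_dimensional Z ->
    (lambda%:E <= ereal_sup [set w : \bar R | exists x y,
       [/\ Z x, Z y, `|x| = 1, `|y| = 1 & w = (p x / p y)%:E]]%R)%E.

(* Main.v *)
(* For each j, the supremum p_j(u) of sums of norms over M_j-admissible
   families is an equivalent norm, |u| <= p_j(u) <= m_j |u|. Every subspace
   contains, up to a small perturbation, averages y_j of rapidly increasing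
   block sequences whose coefficients come from the choice of s_j, with
   |y_j| between 1/m_j and 5/m_j. Since y_j is spread over an M_j-admissible
   family, p_j(y_j) >= 1, whereas p_j(y_{j+1}) <= 5/m_{j+1}. Normalizing y_j
   and y_{j+1}, the ratio of the values of p_j is at least a constant times m_j.

   The blocks of a rapidly increasing sequence are flat: sums of norms of
   restrictions over families of low complexity are at most 4. They come from
   the argument of James: if all averages of a block sequence had norm below
   1/2, iterating l_j times would give a unit vector contradicting the
   M_j-admissible lower bound, because 2^(l_j) > 2 m_j.

   The upper estimates compare a combination of blocks with the combination, with the
   same coefficients, of unit vectors in the auxiliary space T[F_k, 1/2]. *)
Require Import Defs.
From mathcomp Require Import all_boot all_order all_algebra finmap zify lra.
From mathcomp Require Import all_classical all_reals all_analysis.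

Set Implicit Arguments.
Unset Strict Implicit.
Unset Printing Implicit Defensive.

Import Order.TTheory GRing.Theory Num.Theory.
Import numFieldNormedType.Exports.

Local Open Scope nat_scope.

(** * Families of finite sets *)

(** The obstacle in comparing with the auxiliary space is that one block may meet several sets of an
    admissible family. Each block is charged to the first set it meets; only the last block charged
    to a set can spill over into later sets. Treating that block separately doubles the number of
    pieces. To keep the doubled family admissible in the auxiliary space, the unit vector that
    represents a block is placed at the start of the next block, beyond the double of every point of
    the block, where the Schreier families can replace one point by two. Moving the unit vectors
    there costs a factor 3, because the coefficients decrease. The upper estimates then follow by
    induction on the number of blocks. For families of index at most [j] the splitting loses only a
    constant factor and never the weight; this is why a sum of norms over such a family stays
    comparable with the norm of the average. All estimates take place in [c00]. A subspace of the
    completion enters only through an abstract predicate [near], whose error is divided by a weight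
    before each normalization. *)

Definition fmin (F : {fset nat}) : nat :=
  xget 0 [set x : nat | x \in F /\ forall y, y \in F -> x <= y]%classic.

Lemma fminP (F : {fset nat}) : F != fset0 ->
  fmin F \in F /\ forall y, y \in F -> fmin F <= y.
Proof.
move=> /fset0Pn[z zF]; 
have ex : exists x, x \in F by exists z.
apply: (@xgetPex _ 0 [set x : nat | x \in F /\ forall y, y \in F -> x <= y]%classic).
by exists (ex_minn ex); case: ex_minnP.
Qed.

Definition before (F G : {fset nat}) : bool :=
  `[< forall x y, x \in F -> y \in G -> x < y >].

Lemma pairwise_enum_ord s (e : rel 'I_s) :
  (forall i j : 'I_s, i < j -> e i j) -> pairwise e (enum 'I_s).
Proof.
move=> he; apply: (sub_pairwise (r := relpre val ltn)) => [i j|]; first exact: he.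
by rewrite -pairwise_map val_enum_ord -sorted_pairwise ?iota_ltn_sorted//; exact: ltn_trans.
Qed.

Definition mins (L : seq {fset nat}) : {fset nat} := [fset fmin G | G in L]%fset.

(** [interlaced] compares neighbours only. As the sets are nonempty, a point of each intermediate
    set links one comparison to the next. *)
Lemma interlaced_lt s (k : 'I_s -> nat) E : interlaced k E ->
  forall i i' : 'I_s, i < i' -> forall x, x \in E i -> x < k i'.
Proof.
move=> [E0 kE Ek].
have lt (d : nat) (i j : 'I_s) : (j = i + d.+1 :> nat)%N ->
    forall n, n \in E i -> (n < k j)%N.
  elim: d j => [|d IH] j ji n ni.
    by apply: (Ek i) => //; rewrite ji addnC.
  have ltd : (i + d.+1 < s)%N.
    by apply: leq_trans (ltn_ord j); rewrite ji !addnS.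
  have /fset0Pn[p pE] := E0 (Ordinal ltd).
  apply: (@leq_ltn_trans p); last first.
    by apply: (Ek (Ordinal ltd)) => //=; rewrite ji addnS.
  apply: leq_trans (kE _ _ pE); exact/ltnW/IH.
move=> i i' ii' x xi; apply: (lt (i' - i.+1)%N i) => //.
by rewrite addnS -addSn subnKC.
Qed.

Lemma interlaced_before s (k : 'I_s -> nat) E : interlaced k E ->
  forall i i' : 'I_s, i < i' -> before (E i) (E i').
Proof.
move=> kE i i' ii'; apply/asboolP => x y xi yi'.
by apply: leq_trans (interlaced_lt kE ii' xi) _; case: kE => _ + _; exact.
Qed.

Lemma interlaced_mono s (k : 'I_s -> nat) E : interlaced k E ->
  forall i i' : 'I_s, i < i' -> k i < k i'.
Proof.
move=> kE i i' ii'; have [/(_ i)/fset0Pn[x xi] /(_ i x xi) kx _] := kE.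
exact: leq_ltn_trans kx (interlaced_lt kE ii' xi).
Qed.

Lemma interlaced_inj s (k : 'I_s -> nat) E : interlaced k E -> injective k.
Proof.
move=> kE i j kij; apply/val_inj/eqP; rewrite eqn_leq.
by apply/andP; split; rewrite leqNgt; apply/negP => /(interlaced_mono kE);
  rewrite kij ltnn.
Qed.

Lemma card_interlaced s (k : 'I_s -> nat) E : interlaced k E ->
  #|` [fset k i | i : 'I_s]%fset| = s.
Proof.
by move=> kE; rewrite card_imfset/= ?size_enum_ord//; exact: interlaced_inj kE.
Qed.

(** The minima of the sets serve as the integers [k]. Families given as lists can be filtered and
    concatenated, which the later arguments do constantly. *)
Lemma admissible_seq (M : set {fset nat}) (L : seq {fset nat}) :
  M (mins L) -> fset0 \notin L -> pairwise before L ->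
  admissible M (fun i : 'I_(size L) => nth fset0 L i).
Proof.
move=> ML L0 Lb; have nz (i : 'I_(size L)) : nth fset0 L i != fset0.
  by apply: contraNneq L0 => <-; exact: mem_nth.
exists (fun i => fmin (nth fset0 L i)); split; last split => //.
- rewrite (_ : [fset _ | i : 'I__]%fset = mins L)//; apply/fsetP => x.
  apply/imfsetP/imfsetP => /= -[].
    by move=> i _ ->; exists (nth fset0 L i) => //; exact: mem_nth.
  move=> G /(nthP fset0)[i iL <-] ->.
  by exists (Ordinal iL).
- by move=> i; have [_] := fminP (nz i).
- move=> i i' ii' j ji; have [h _] := fminP (nz i').
  have /(pairwiseP fset0)/(_ i i') := Lb.
  by rewrite !inE !ltn_ord ii' ltnSn => /(_ isT isT isT)/asboolP; apply; rewrite -?ii'.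
Qed.

Lemma family_prod_seq (M N : set {fset nat}) (L : seq {fset nat}) :
  M (mins L) -> fset0 \notin L -> pairwise before L ->
  (forall G, G \in L -> N G) ->
  family_prod M N (\big[@fsetU nat/fset0]_(G <- L) G).
Proof.
move=> ML L0 Lb NL; exists (size L), (fun i => nth fset0 L i); split.
- by move=> i; apply: NL; exact: mem_nth.
- exact: admissible_seq.
- by rewrite (big_nth fset0) big_mkord.
Qed.

Lemma mem_bigfsetU (I : eqType) (r : seq I) (F : I -> {fset nat}) x :
  (x \in \big[@fsetU nat/fset0]_(i <- r) F i) = has (fun i => x \in F i) r.
Proof. by elim: r => [|i r IH]; rewrite ?big_nil ?big_cons inE// IH. Qed.

Lemma mem_bigfsetU_ord s (F : 'I_s -> {fset nat}) x :
  x \in \big[@fsetU nat/fset0]_(i < s) F i <-> exists i, x \in F i.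
Proof.
rewrite mem_bigfsetU; split => [/hasP[i _]|[i xi]]; first by exists i.
by apply/hasP; exists i => //; rewrite mem_index_enum.
Qed.

Lemma card_mins L : #|` mins L| <= size L.
Proof.
rewrite /mins; apply: leq_trans (leq_imfset_card _ _ _) _ => /=.
by rewrite /in_mem/= size_undup.
Qed.

Lemma beforeP F G : reflect (forall x y, x \in F -> y \in G -> x < y) (before F G).
Proof. exact: asboolP. Qed.

Lemma before_sub F F' G G' : {subset F' <= F} -> {subset G' <= G} ->
  before F G -> before F' G'.
Proof. by move=> sF sG /beforeP h; apply/beforeP => x y /sF + /sG; exact: h. Qed.

Lemma schreier_iter_gt0 n F : schreier_iter n F -> forall x, x \in F -> 0 < x.
Proof.
elim: n F => [|n IH] F /=.
  by move=> [i i0 ->] x; rewrite inE => /eqP ->.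
by move=> [s [E [NE _ ->]]] x /mem_bigfsetU_ord[i]; exact: IH.
Qed.

Lemma fmin1 x : fmin [fset x]%fset = x.
Proof.
have [|] := @fminP [fset x]%fset; first by apply/fset0Pn; exists x; rewrite inE.
by rewrite inE => /eqP.
Qed.

(** [F] is cut into its points; the minima of the pieces form [F] again. *)
Lemma family_prod_singletons (M N : set {fset nat}) (F : {fset nat}) :
  M F -> (forall x, x \in F -> N [fset x]%fset) -> family_prod M N F.
Proof.
move=> MF N1; pose L := [seq [fset x]%fset | x <- sort leq F].
have -> : F = \big[@fsetU nat/fset0]_(G <- L) G.
  apply/fsetP => x; rewrite mem_bigfsetU; apply/idP/hasP => [xF|].
    exists [fset x]%fset; last by rewrite inE.
    by apply: map_f; rewrite mem_sort.
  by move=> [_ /mapP[y + ->]]; rewrite mem_sort inE => yF /eqP ->.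
apply: family_prod_seq.
- rewrite (_ : mins L = F)//; apply/fsetP => x; apply/imfsetP/idP => /=.
    by move=> [_ /mapP[y + ->] ->]; rewrite mem_sort fmin1.
  move=> xF; exists [fset x]%fset; last by rewrite fmin1.
  by apply: map_f; rewrite mem_sort.
- by apply/mapP => -[y _ /fsetP/(_ y)]; rewrite !inE eqxx.
- rewrite pairwise_map; apply: (@sub_pairwise _ ltn).
    by move=> x y /= xy; apply/beforeP => a b; rewrite !inE => /eqP -> /eqP ->.
  rewrite -sorted_pairwise; last exact: ltn_trans.
  by rewrite ltn_sorted_uniq_leq sort_uniq fset_uniq sort_sorted//; exact: leq_total.
- by move=> _ /mapP[y + ->]; rewrite mem_sort => yF; exact: N1.
Qed.

Lemma schreier_iter1 F : schreier F -> (forall x, x \in F -> 0 < x) ->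
  schreier_iter 1 F.
Proof.
by move=> sF F0; apply: family_prod_singletons => // x xF; exists x => //; exact: F0.
Qed.

(** A union of [s] singletons has at most [s] points, while [s] is the cardinality of the set of the
    [k j] and hence bounds each of them from below. *)
Lemma schreier_iter1_card F : schreier_iter 1 F -> schreier F.
Proof.
move=> [s [E [NE [k [sk kE] ->]]]] i /mem_bigfsetU_ord[j ij].
have [_ kj _] := kE; apply: leq_trans (kj j i ij).
have kk : k j \in [fset k i | i : 'I_s]%fset by apply/imfsetP; exists j.
apply: leq_trans (sk _ kk); rewrite (card_interlaced kE).
pose g i := xget 0 [set x | E i = [fset x]%fset]%classic.
have gE i' : E i' = [fset (g i')]%fset.
  have [x _ Ex] := NE i'.
  by apply: (@xgetPex _ 0 [set x | E i' = [fset x]%fset]%classic); exists x.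
suff -> : \big[@fsetU nat/fset0]_(i0 < s) E i0 = [fset g i | i : 'I_s]%fset.
  by apply: leq_trans (leq_imfset_card _ _ _) _; rewrite /= size_enum_ord.
apply/fsetP => x; apply/idP/imfsetP => [/mem_bigfsetU_ord[i' ]|[i' _ ->]].
  by rewrite gE inE => /eqP ->; exists i'.
by apply/mem_bigfsetU_ord; exists i'; rewrite gE inE.
Qed.

(* With [c = 1] this says that the family is hereditary and spreading; with
   [c = 2] it allows each point of [F] to be replaced by two points that lie
   beyond its double. *)
Lemma schreier_iter_spread c n (F T : {fset nat}) (p : nat -> nat) :
  0 < c -> schreier_iter n.+1 F ->
  (forall x, x \in T -> p x \in F) -> (forall x, x \in T -> c * p x <= x) ->
  {in T &, {homo p : x y / x <= y}} ->
  (forall y, #|` [fset x in T | p x == y]%fset| <= c) ->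
  schreier_iter n.+1 T.
Proof.
move=> c0; elim: n F T => [|n IH] F T nF TF px hp fib.
  (* Only at level one does the number of points grow by the factor [c]: #T <= c * #F <= c * p x <=
     x. The singletons of [schreier_iter 0] leave no room for this, hence the index [n.+1]. *)
  have F0 := schreier_iter_gt0 nF.
  apply: schreier_iter1; last first.
    move=> x xT; apply: leq_trans (px x xT); rewrite muln_gt0 c0; exact: F0 (TF x xT).
  move=> x xT; apply: leq_trans (px x xT).
  apply: (@leq_trans (c * #|` F|)); last first.
    by rewrite leq_mul2l (schreier_iter1_card nF) ?orbT ?TF.
  have -> : T = \big[@fsetU nat/fset0]_(y <- F) [fset x in T | p x == y]%fset.
    apply/fsetP => z; rewrite mem_bigfsetU; apply/idP/hasP => [zT|[y _]].
      by exists (p z); [exact: TF|rewrite !inE zT eqxx].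
    by rewrite !inE => /andP[].
  rewrite mulnC -[#|` F|]sum1_size big_distrl/=.
  elim/big_rec2 : _ => [|y u v _ uv]; first by rewrite cardfs0.
  rewrite mul1n; apply: leq_trans (leq_add (fib y) uv).
  by rewrite cardfsU leq_subr.
move: nF => [s [E [NE [k [sk kE]] FE]]].
pose T' i := [fset x in T | p x \in E i]%fset.
pose L := [seq G <- [seq T' i | i <- enum 'I_s] | G != fset0].
have T'b (i i' : 'I_s) : i < i' -> before (T' i) (T' i').
  move=> ii'; apply/beforeP => x y; rewrite !inE => /andP[xT xi] /andP[yT yi'].
  rewrite ltnNge; apply/negP => yx.
  have := hp _ _ yT xT yx; apply/negP; rewrite -ltnNge.
  by have /beforeP := interlaced_before kE ii'; exact.
have TE : T = \big[@fsetU nat/fset0]_(G <- L) G.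
  apply/fsetP => x; rewrite mem_bigfsetU; apply/idP/hasP => [xT|[G]].
    have : p x \in F by exact: TF.
    rewrite FE => /mem_bigfsetU_ord[i pi].
    have xi : x \in T' i by rewrite !inE xT.
    exists (T' i) => //; rewrite mem_filter map_f ?mem_enum// andbT.
    by apply/fset0Pn; exists x.
  by rewrite mem_filter => /andP[_ /mapP[i _ ->]]; rewrite !inE => /andP[].
rewrite TE; apply: family_prod_seq.
(* At higher levels the number of pieces does not grow: at most [s] preimages are nonempty, and s <=
   k i <= p (fmin G) <= fmin G. *)
- move=> x /imfsetP[/= G + ->]; rewrite mem_filter => /andP[G0 /mapP[i _ GE]].
  have [+ _] := fminP G0; rewrite {2}GE !inE => /andP[xT pE].
  apply: leq_trans (px _ xT); apply: (@leq_trans (p (fmin G))); last exact: leq_pmull.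
  have [_ kj _] := kE; apply: leq_trans (kj i _ pE).
  have kk : k i \in [fset k i | i : 'I_s]%fset by apply/imfsetP; exists i.
  apply: leq_trans (sk _ kk); rewrite (card_interlaced kE).
  apply: leq_trans (card_mins _) _; rewrite size_filter.
  by apply: leq_trans (count_size _ _) _; rewrite size_map size_enum_ord.
- by rewrite mem_filter eqxx.
- by apply: pairwise_filter; rewrite pairwise_map; apply: pairwise_enum_ord.
- move=> G; rewrite mem_filter => /andP[G0 /mapP[i _ ->]].
  apply: (IH (E i)).
  + exact: NE.
  + by move=> x; rewrite !inE => /andP[].
  + by move=> x; rewrite !inE => /andP[xT _]; exact: px.
  + by move=> x y; rewrite !inE => /andP[xT _] /andP[yT _]; exact: hp.
  + move=> y; apply: leq_trans (fib y); apply: fsubset_leq_card.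
    by apply/fsubsetP => x; rewrite !inE => /andP[/andP[-> _] ->].
Qed.

Lemma schreier_iter_single n x : 0 < x -> schreier_iter n [fset x]%fset.
Proof.
move=> x0; elim: n => [|n IH]; first by exists x.
have := @family_prod_seq schreier (schreier_iter n) [:: [fset x]%fset].
rewrite big_seq1; apply => //.
- move=> y /imfsetP[/= G]; rewrite inE => /eqP -> ->; rewrite fmin1.
  by apply: leq_trans x0; exact: card_mins.
- by rewrite inE; apply/eqP => /fsetP/(_ x); rewrite !inE eqxx.
- by move=> G; rewrite inE => /eqP ->.
Qed.

Lemma family_prod_subr (M N N' : set {fset nat}) :
  (N `<=` N' -> family_prod M N `<=` family_prod M N')%classic.
Proof. by move=> NN' F [s [E [NE ME FE]]]; exists s, E; split=> // i; exact: NN'. Qed.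

Lemma schreier_iter_sub_prod n (N : set {fset nat}) :
  (forall x, 0 < x -> N [fset x]%fset) ->
  (schreier_iter n `<=` family_prod (schreier_iter n) N)%classic.
Proof.
move=> N1 F nF; apply: family_prod_singletons => // x xF.
exact/N1/(schreier_iter_gt0 nF).
Qed.

Local Open Scope ring_scope.

(** * Tsirelson type norms *)

Section C00.
Variable R : realType.
Implicit Types (x y : c00 R) (E F : {fset nat}).

Lemma c00_eq x y : (forall n, x n = y n) -> x = y.
Proof. by move=> xy; apply/val_inj/funext. Qed.

Lemma c00D x y n : (x + y) n = x n + y n. Proof. by []. Qed.
Lemma c00B x y n : (x - y) n = x n - y n. Proof. by []. Qed.
Lemma c00Z a x n : (a *: x) n = a * x n. Proof. by []. Qed.

Lemma c00_sum (I : Type) (r : seq I) (P : pred I) (F : I -> c00 R) n :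
  (\sum_(i <- r | P i) F i) n = \sum_(i <- r | P i) F i n.
Proof. by apply: (big_morph (fun x : c00 R => x n)). Qed.

Lemma restrE E x n : restr E x n = if n \in E then x n else 0.
Proof. by []. Qed.

Lemma restrD E x y : restr E (x + y) = restr E x + restr E y.
Proof. by apply: c00_eq => n; rewrite !(c00D, restrE); case: ifP; rewrite ?addr0. Qed.

Lemma restrZ E a x : restr E (a *: x) = a *: restr E x.
Proof. by apply: c00_eq => n; rewrite !(c00Z, restrE); case: ifP; rewrite ?mulr0. Qed.

Lemma restr0 E : restr E (0 : c00 R) = 0.
Proof. by apply: c00_eq => n; rewrite restrE; case: ifP. Qed.

Lemma restr_set0 x : restr fset0 x = 0.
Proof. by apply: c00_eq => n; rewrite restrE. Qed.

Lemma restr_sum E (I : Type) (r : seq I) (P : pred I) (F : I -> c00 R) :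
  restr E (\sum_(i <- r | P i) F i) = \sum_(i <- r | P i) restr E (F i).
Proof. by apply: (big_morph (restr E)); [exact: restrD|exact: restr0]. Qed.

Lemma restr_restr E F x : restr E (restr F x) = restr (E `&` F)%fset x.
Proof. by apply: c00_eq => n; rewrite !restrE inE; case: (n \in E). Qed.

Lemma restr_id E x : (forall n, x n != 0 -> n \in E) -> restr E x = x.
Proof.
move=> xE; apply: c00_eq => n; rewrite restrE; case: ifPn => // nE.
by apply/esym/eqP; apply: contraNT nE; exact: xE.
Qed.

Lemma restr_eq0 E x : (forall n, n \in E -> x n = 0) -> restr E x = 0.
Proof. by move=> h; apply: c00_eq => n; rewrite restrE; case: ifP => // /h. Qed.

Lemma restr_neq0 E x : restr E x != 0 -> exists2 n, n \in E & x n != 0.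
Proof.
move=> h; apply: contrapT => nex; move/eqP: h; apply; apply: restr_eq0 => n nE.
by apply/eqP; apply: contrapT => /negP xn; apply: nex; exists n.
Qed.

Lemma c00_neq0 x : x != 0 -> exists n, x n != 0.
Proof.
move=> /eqP h; apply: contrapT => nex; apply: h; apply: c00_eq => n; apply/eqP.
by apply: contrapT => /negP xn; apply: nex; exists n.
Qed.

Lemma c00_unitE n i : (0 < n)%N -> c00_unit R n i = (i == n)%:R.
Proof. by move=> n0; rewrite /= /c00_unit_fun n0. Qed.

End C00.

Section Norm.
Variables (R : realType) (K : Type) (M : K -> set {fset nat}) (theta : K -> R).
Variable N : c00 R -> R.
Hypothesis hN : is_tsirelson_norm M theta N.
Hypothesis theta_gt0 : forall k, 0 < theta k.

Lemma tsiD x y : N (x + y) <= N x + N y. Proof. by have [[]] := hN. Qed.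

Lemma tsiZ a x : N (a *: x) = `|a| * N x. Proof. by have [[]] := hN. Qed.

Lemma tsi0 : N 0 = 0.
Proof. by have := tsiZ 0 0; rewrite scale0r normr0 mul0r. Qed.

Lemma tsi_coord (x : c00 R) n : `|x n| <= N x.
Proof.
have [_ NE] := hN; rewrite -lee_fin NE le_max; apply/orP; left.
by apply: ereal_sup_ubound; exists n.
Qed.

Lemma tsi_ge0 x : 0 <= N x.
Proof. exact: le_trans (tsi_coord x 0%N). Qed.

Lemma tsi_sum (I : Type) (r : seq I) (P : pred I) (F : I -> c00 R) :
  N (\sum_(i <- r | P i) F i) <= \sum_(i <- r | P i) N (F i).
Proof.
elim/big_rec2 : _ => [|i a b _ ab]; first by rewrite tsi0.
by apply: le_trans (tsiD _ _) _; rewrite lerD2l.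
Qed.

Lemma tsi_adm x k s (E : 'I_s -> {fset nat}) : admissible (M k) E ->
  theta k * \sum_(i < s) N (restr (E i) x) <= N x.
Proof.
move=> ME; have [_ NE] := hN; rewrite -lee_fin NE le_max; apply/orP; right.
apply: le_ereal_sup_tmp; eexists; first by exists k.
rewrite EFinM lee_pmul2l//; last by rewrite lte_fin.
by apply: ereal_sup_ubound; exists s, E.
Qed.

Lemma tsi_le (x : c00 R) B : (forall n, `|x n| <= B) ->
  (forall k s (E : 'I_s -> {fset nat}), admissible (M k) E ->
     theta k * \sum_(i < s) N (restr (E i) x) <= B) -> N x <= B.
Proof.
move=> xB EB; have [_ NE] := hN; rewrite -lee_fin NE ge_max; apply/andP; split.
  by apply: ge_ereal_sup => _ [n _ <-]; rewrite lee_fin.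
apply: ge_ereal_sup => _ [k _ <-].
rewrite -ereal_sup_pZl//; apply: ge_ereal_sup => _ [_ [s [E [ME ->]]] <-].
by rewrite -EFinM lee_fin; exact: EB.
Qed.

Lemma tsi_seq x k (L : seq {fset nat}) :
  M k (mins [seq G <- L | G != fset0]) -> pairwise before L ->
  theta k * \sum_(G <- L) N (restr G x) <= N x.
Proof.
move=> ML Lb; set L' := [seq G <- L | G != fset0].
have -> : \sum_(G <- L) N (restr G x) = \sum_(i < size L') N (restr (nth fset0 L' i) x).
  transitivity (\sum_(G <- L') N (restr G x)); last by rewrite (big_nth fset0) big_mkord.
  rewrite big_filter [RHS]big_mkcond; apply: eq_bigr => G _.
  by case: eqP => [->|]//=; rewrite restr_set0 tsi0.
apply: tsi_adm; apply: admissible_seq => //.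
  by rewrite mem_filter eqxx.
exact: pairwise_filter.
Qed.

Hypothesis theta_half : forall k, theta k <= 2^-1.

(** Induction on the size of the support. In the implicit equation for [restr E x], either every
    piece of [x] has smaller support, or one set contains the whole support; then the sum reduces to
    N (restr E x) itself, and the weight at most 1/2 makes this alternative harmless. *)
Lemma tsi_restr E x : N (restr E x) <= N x.
Proof.
have [n] := ubnP #|` c00_supp x|; elim: n x => // n IH x; rewrite ltnS => xn.
suff : N (restr E x) <= Num.max (N x) (2^-1 * N (restr E x)).
  by rewrite le_max => /orP[//|]; have := tsi_ge0 (restr E x); have := tsi_ge0 x; lra.
apply: tsi_le => [i|k s G MG]; rewrite le_max.
  by rewrite restrE; case: ifP => _; rewrite ?normr0 ?tsi_ge0// tsi_coord.
have [k0 [Mk kG]] := MG.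
have [i iE|nE] := pickP (fun i => c00_supp x `<=` G i)%fset.
  have dis j : j != i -> restr (G j) x = 0.
    move=> ji; apply: restr_eq0 => p pj; apply/eqP; apply: contraNT ji => xp.
    have pi : p \in G i by apply: (fsubsetP iE); rewrite mem_c00_supp.
    apply/eqP/val_inj; case: (ltngtP (val j) (val i)) => // h.
      by have /beforeP/(_ _ _ pj pi) := interlaced_before kG h; rewrite ltnn.
    by have /beforeP/(_ _ _ pi pj) := interlaced_before kG h; rewrite ltnn.
  have disE j : j != i -> restr (G j) (restr E x) = 0.
    by move=> ji; rewrite restr_restr fsetIC -restr_restr dis// restr0.
  rewrite (bigD1 i)//= big1 => [|j ji]; last by rewrite disE// tsi0.
  have Gx : restr (G i) x = x.
    by apply: restr_id => p xp; apply: (fsubsetP iE); rewrite mem_c00_supp.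
  rewrite addr0 restr_restr fsetIC -restr_restr Gx.
  by apply/orP; right; rewrite ler_wpM2r// tsi_ge0.
apply/orP; left; apply: le_trans (tsi_adm x MG); rewrite ler_wpM2l ?(ltW (theta_gt0 k))//.
apply: ler_sum => i _; rewrite restr_restr fsetIC -restr_restr; apply: IH.
apply: leq_trans xn; apply: fproper_ltn_card; rewrite fproperE; apply/andP; split.
  apply/fsubsetP => p; rewrite !mem_c00_supp restrE.
  by case: ifP => //; rewrite eqxx.
have /negbT/fsubsetPn[p px pi] := nE i; apply/negP => /fsubsetP/(_ p px).
by rewrite mem_c00_supp restrE (negbTE pi) eqxx.
Qed.

End Norm.

(** * Splitting a combination of blocks *)

Lemma pairwise_flatten2 (I T : Type) (e : rel T) (f g : I -> T) (s : seq I) :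
  (forall i, e (f i) (g i)) ->
  pairwise (fun i j => [&& e (f i) (f j), e (f i) (g j), e (g i) (f j) & e (g i) (g j)]) s ->
  pairwise e (flatten [seq [:: f i; g i] | i <- s]).
Proof.
have all2 (p : pred T) t : all (fun j => p (f j) && p (g j)) t ->
    all p (flatten [seq [:: f i; g i] | i <- t]).
  by elim: t => //= j t IH /andP[/andP[-> ->]] /IH.
move=> efg; elim: s => //= i s IH /andP[ih /IH ->]; rewrite andbT efg/=.
by apply/andP; split; apply: all2; apply: sub_all ih => j /and4P[h1 h2 h3 h4]; apply/andP.
Qed.

(** The factor 2 leaves a gap before the next block: [r k.+1] lies beyond the double of each point
    of block [k], as [schreier_iter_spread] with c = 2 requires. *)
Definition block_sequence (R : realType) (x : nat -> c00 R) (r : nat -> nat) :=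
  forall k, (r k < r k.+1)%N /\
    forall n, x k n != 0 -> (r k <= n)%N /\ (2 * n <= r k.+1)%N.

Section Blocks.
Variables (R : realType) (x : nat -> c00 R) (r : nat -> nat).
Hypothesis hxr : block_sequence x r.

Lemma block_index_homo : {homo r : i j / (i < j)%N}.
Proof. by apply: homo_ltn => [i j k|i]; [exact: ltn_trans|have [] := hxr i]. Qed.

Lemma block_index_mono : {mono r : i j / (i < j)%N}.
Proof. exact/leqW_mono/leq_mono/block_index_homo. Qed.

Lemma block_index_inj : injective r.
Proof. exact/incn_inj/leq_mono/block_index_homo. Qed.

Lemma block_lt k k' n n' : (k < k')%N -> x k n != 0 -> x k' n' != 0 -> (n < n')%N.
Proof.
move=> kk' xn xn'; have n0 : (0 < n)%N by case: n xn => //; rewrite c00P eqxx.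
have [_ /(_ n xn)[_ h]] := hxr k; have [_ /(_ n' xn')[h' _]] := hxr k'.
have : (r k.+1 <= r k')%N by rewrite (leq_mono block_index_homo).
lia.
Qed.

End Blocks.

Section Split.
Variables (R : realType) (n : nat) (P : c00 R -> R).
Hypothesis hP : is_tsirelson_norm (fun _ : unit => schreier_iter n.+1)
  (fun=> 2^-1) P.
Variables (x : nat -> c00 R) (r : nat -> nat) (a : nat -> R) (q : nat).
Hypothesis hxr : block_sequence x r.
Hypothesis a_ge0 : forall k, 0 <= a k.
Implicit Types A G : {set 'I_q}.

Let half_gt0 (u : unit) : 0 < (2^-1 : R). Proof. by rewrite invr_gt0. Qed.

Definition block_comb A : c00 R := \sum_(k in A) a k *: x k.

(* The unit vector attached to the k-th block lies to the right of that block: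
   this is the direction in which the Schreier families are spreading. *)
Definition unit_comb A : c00 R := \sum_(k in A) a k *: c00_unit R (r k.+1).

Let mu A := P (unit_comb A).
Let mass A := \sum_(k in A) a k.

Definition unit_supp A : {fset nat} := [fset r (val k).+1 | k in A]%fset.

Lemma mem_unit_supp A (k : 'I_q) : (r k.+1 \in unit_supp A) = (k \in A).
Proof.
apply/imfsetP/idP => [[k' /= k'A]|kA]; last by exists k.
by move=> /(block_index_inj hxr)[] /val_inj ->.
Qed.

Lemma unit_suppP A n' : n' \in unit_supp A -> exists2 k, k \in A & n' = r (val k).+1.
Proof. by move=> /imfsetP[k /= kA ->]; exists k. Qed.

Let r_gt0 k : (0 < r k.+1)%N.
Proof. by have [+ _] := hxr k; exact: leq_ltn_trans. Qed.

Lemma restr_unit_comb A G : G \subset A ->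
  restr (unit_supp G) (unit_comb A) = unit_comb G.
Proof.
move=> GA; rewrite restr_sum [RHS](big_setID A)/= [X in _ + X]big1 ?addr0; last first.
  by move=> k; rewrite inE => /andP[/negP + /(fintype.subsetP GA)].
rewrite (finset.setIidPl GA) [LHS](big_setID G)/= [X in _ + X]big1 ?addr0; last first.
  move=> k; rewrite inE => /andP[kG _]; apply: restr_eq0 => m mG.
  rewrite c00Z c00_unitE//; have [mE|] := eqVneq m (r k.+1); last by rewrite mulr0.
  by move: mG; rewrite mE mem_unit_supp (negbTE kG).
rewrite (finset.setIidPr GA); apply: eq_bigr => k kG; apply: restr_id => m.
rewrite c00Z c00_unitE//; have [->|] := eqVneq m (r k.+1); last by rewrite mulr0 eqxx.
by rewrite mem_unit_supp.
Qed.

Lemma coef_le_unit_comb A k : k \in A -> a k <= P (unit_comb A).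
Proof.
move=> kA; apply: le_trans (tsi_coord hP _ (r k.+1)).
rewrite c00_sum (bigD1 k)// big1 => [|k' /andP[_ k'k]].
  by rewrite c00Z c00_unitE// eqxx mulr1 /= addr0 ger0_norm.
rewrite c00Z c00_unitE//; case: eqP; last by rewrite mulr0.
by move=> /(block_index_inj hxr)[] /val_inj kk; rewrite kk eqxx in k'k.
Qed.

(** The factor 2 is the inverse of the weight of the auxiliary norm. *)
Lemma sum_unit_comb_le A (L : seq {set 'I_q}) :
  (forall G, G \in L -> G \subset A) ->
  schreier_iter n.+1 (mins [seq G <- [seq unit_supp G | G <- L] | G != fset0]) ->
  pairwise before [seq unit_supp G | G <- L] ->
  \sum_(G <- L) P (unit_comb G) <= 2 * P (unit_comb A).
Proof.
move=> LA sL Lb; have := tsi_seq hP half_gt0 (unit_comb A) (k := tt) sL Lb.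
rewrite big_map mulrC ler_pdivrMr// mulrC; apply: le_trans.
rewrite le_eqVlt; apply/orP; left; apply/eqP; apply: eq_big_seq => G GL.
by rewrite restr_unit_comb// LA.
Qed.

Variables (N : c00 R -> R).
Variables (KN : Type) (M : KN -> set {fset nat}) (theta : KN -> R).
Hypothesis hN : is_tsirelson_norm M theta N.
Hypothesis theta_gt0 : forall k, 0 < theta k.

Variables (s : nat) (kap : 'I_s -> nat) (E : 'I_s -> {fset nat}).
Hypothesis kap_schreier : schreier_iter n.+1 [fset kap i | i : 'I_s]%fset.
Hypothesis kap_homo : forall i j : 'I_s, (i < j)%N -> (kap i < kap j)%N.
Hypothesis kap_le : forall i m, m \in E i -> (kap i <= m)%N.
Hypothesis E_before : forall i j : 'I_s, (i < j)%N -> before (E i) (E j).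

Let meet_homo i i' k k' : restr (E i) (x k) != 0 -> restr (E i') (x k') != 0 ->
  (k < k')%N -> (i <= i')%N.
Proof.
move=> /restr_neq0[m mE xm] /restr_neq0[m' mE' xm'] kk'.
have := block_lt hxr kk' xm xm'; rewrite [(i <= _)%N]leqNgt; apply: contraTN => ii'.
have /beforeP/(_ _ _ mE' mE) := E_before ii'; lia.
Qed.

(* A block is charged to the first of the sets E_i that meets it. Among the
   blocks charged to E_i only the last one can meet another E_j. *)
Lemma split_block_comb A (c : R) : A != finset.set0 ->
  (forall k, k \in A -> \sum_(i < s) N (restr (E i) (x (val k))) <= c) ->
  exists (L : 'I_s -> {set 'I_q}) (e : R),
  [/\ forall i, L i \proper A,
      \sum_(i < s) N (restr (E i) (block_comb A)) <=
        \sum_(i < s) N (restr (E i) (block_comb (L i))) + c * e,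
      \sum_(i < s) mu (L i) + e <= 2 * mu A &
      \sum_(i < s) mass (L i) <= mass A].
Proof.
move=> A0 xc.
have c0 : 0 <= c.
  have /finset.set0Pn[k kA] := A0; apply: le_trans (xc k kA).
  by apply: sumr_ge0 => i _; exact: tsi_ge0 hN _.
pose fst (i : 'I_s) (k : 'I_q) := (restr (E i) (x k) != 0) &&
  [forall i' : 'I_s, (i' < i)%N ==> (restr (E i') (x k) == 0)].
have fst_uniq i i' k : fst i k -> fst i' k -> i = i'.
  move=> /andP[ik /forallP iN] /andP[i'k /forallP i'N].
  apply/val_inj; case: (ltngtP (val i) (val i')) => // h.
    by have := i'N i; rewrite h/= (negbTE ik).
  by have := iN i'; rewrite h/= (negbTE i'k).
have fst_ex (i : 'I_s) (k : 'I_q) : restr (E i) (x k) != 0 -> exists2 i', fst i' k & (i' <= i)%N.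
  move=> ik; case: (@arg_minnP _ i (fun i => restr (E i) (x k) != 0) val ik) => i' i'k mi.
  exists i'; last exact: mi.
  rewrite /fst i'k/=; apply/forallP => j; apply/implyP; apply: contraTT => jk.
  by rewrite -leqNgt; exact: mi.
(* [A_ i] holds the blocks charged to E_i, [L i] those followed by another block of [A_ i], and
   [B i] the last one. A block of [L i] meets no set but E_i; a block of [B i] may meet others, and
   the term [e] pays for it. *)
pose A_ i := [set k in A | fst i k].
pose L i := [set k in A_ i | [exists k' in A_ i, (k < k')%N]].
pose B i := A_ i :\: L i.
have LA i : L i \subset A_ i by apply/fintype.subsetP => k; rewrite inE => /andP[].
have BA i : B i \subset A_ i by exact: finset.subsetDl.
have AA i : A_ i \subset A by apply/fintype.subsetP => k; rewrite inE => /andP[].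
have A_lt (i i' : 'I_s) (k k' : 'I_q) : (i < i')%N -> k \in A_ i -> k' \in A_ i' -> (k < k')%N.
  rewrite !inE => ii' /andP[_ ik] /andP[_ i'k'].
  have [//|kk'|/val_inj kk'] := ltngtP (val k) (val k').
    have := meet_homo (proj1 (andP i'k')) (proj1 (andP ik)) kk'.
    by rewrite leqNgt ii'.
  by rewrite kk' in ik; rewrite (fst_uniq _ _ _ ik i'k') ltnn in ii'.
have L_meet i i' k : k \in L i -> restr (E i') (x (val k)) != 0 -> i' = i.
  rewrite inE => /andP[+ /exists_inP[k' ]].
  rewrite !inE => /andP[_ ik] /andP[_ ik'] kk' i'k.
  apply/val_inj/eqP; rewrite eqn_leq (meet_homo i'k (proj1 (andP ik')) kk')/=.
  have [i0 i0k i0i'] := fst_ex _ _ i'k.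
  by rewrite (fst_uniq _ _ _ ik i0k).
have B_max i (k k' : 'I_q) : k \in B i -> k' \in A_ i -> (k' <= k)%N.
  move=> /finset.setDP[kA kL] k'A; rewrite leqNgt; apply: contraNN kL => kk'.
  by rewrite inE kA/=; apply/exists_inP; exists k'.
exists L, (\sum_(i < s) mu (B i)); split.
- move=> i; apply/fintype.properP; split; first exact: fintype.subset_trans (LA i) (AA i).
  (* The greatest index of [A] lies in no [L i]. This strict inclusion is what lets [ris_bound]
     proceed by induction on [A]. *)
  have /finset.set0Pn[k0 k0A] := A0.
  have [k kA kmax] := @arg_maxnP _ k0 (fun k => k \in A) val k0A.
  exists k => //; apply/negP; rewrite inE => /andP[_ /exists_inP[k' /(fintype.subsetP (AA i)) /kmax]].
  by move=> h /(leq_ltn_trans h); rewrite ltnn.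
(* A block that meets E_i is either in [L i] or the last block charged to some E_i'. *)
- have decomp i : restr (E i) (block_comb A) = restr (E i) (block_comb (L i)) +
      \sum_(i' < s) \sum_(k in B i') a k *: restr (E i) (x k).
    rewrite /block_comb !restr_sum.
    under [X in X + _]eq_bigr do rewrite restrZ.
    under [LHS]eq_bigr do rewrite restrZ.
    rewrite big_mkcond/= [X in X + _]big_mkcond/=.
    under [X in _ + X]eq_bigr do rewrite big_mkcond/=.
    rewrite exchange_big/= -big_split/=; apply: eq_bigr => k _.
    have [->|ik] := eqVneq (restr (E i) (x k)) 0.
      rewrite scaler0 !if_same add0r big1// => i' _; by rewrite if_same.
    have [i0 i0k _] := fst_ex _ _ ik.
    have [kA|kA] := boolP (k \in A); last first.
      rewrite ifN; last by apply: contra kA => /(fintype.subsetP (LA i))/(fintype.subsetP (AA i)).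
      rewrite add0r big1// => i' _; rewrite ifN//.
      by apply: contra kA => /(fintype.subsetP (BA i'))/(fintype.subsetP (AA i')).
    have kA0 : k \in A_ i0 by rewrite inE kA.
    have [kL|kL] := boolP (k \in L i0).
      rewrite (L_meet _ _ _ kL ik) kL big1 ?addr0// => i' _; rewrite ifN//.
      apply/negP => kB; have := fintype.subsetP (BA i') _ kB; rewrite inE kA/= => i'k.
      by move: kB; rewrite (fst_uniq _ _ _ i'k i0k) => /finset.setDP[_]; rewrite kL.
    rewrite ifN; last first.
      apply/negP => kLi; have := fintype.subsetP (LA i) _ kLi; rewrite inE kA/= => i'k.
      by move: kLi; rewrite (fst_uniq _ _ _ i'k i0k); apply/negP.
    rewrite add0r (bigD1 i0)//= big1 ?addr0.
      by rewrite finset.in_setD kL kA0.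
    move=> i' i'i0; rewrite ifN//; apply/negP => /(fintype.subsetP (BA i')).
    rewrite inE kA/= => i'k; by rewrite (fst_uniq _ _ _ i'k i0k) eqxx in i'i0.
  apply: (@le_trans _ _ (\sum_(i < s) (N (restr (E i) (block_comb (L i))) +
      \sum_(i' < s) \sum_(k in B i') a k * N (restr (E i) (x k))))).
    apply: ler_sum => i _; rewrite decomp; apply: le_trans (tsiD hN _ _) _.
    rewrite lerD2l; apply: le_trans (tsi_sum hN _ _ _) _; apply: ler_sum => i' _.
    apply: le_trans (tsi_sum hN _ _ _) _; apply: ler_sum => k _.
    by rewrite (tsiZ hN) ger0_norm.
  (* Summed over all the sets E_i at once, a last block [k] costs at most c * a k. Since [B i] has
     at most one element, a k <= mu (B i). *)
  rewrite big_split/= lerD2l exchange_big/= mulr_sumr; apply: ler_sum => i _.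
  rewrite exchange_big/=; apply: (@le_trans _ _ (\sum_(k in B i) c * a k)).
    apply: ler_sum => k kB; rewrite -mulr_sumr mulrC ler_wpM2r//; apply: xc.
    exact/(fintype.subsetP (AA i))/(fintype.subsetP (BA i)).
  rewrite -mulr_sumr ler_wpM2l//.
  have [B0|[k kB]] := set_0Vmem (B i).
    by rewrite B0 big_set0; exact: tsi_ge0 hP _.
  have -> : B i = [set k].
    apply/finset.setP => k'; rewrite finset.in_set1; apply/idP/eqP => [k'B|->//].
    apply/val_inj/eqP; rewrite eqn_leq (B_max i k)//= ?(B_max i k')//.
    + exact: (fintype.subsetP (BA i)).
    + exact: (fintype.subsetP (BA i)).
  by rewrite big_set1; apply: coef_le_unit_comb; rewrite finset.in_set1.
- rewrite -big_split/=.
  pose Ls := flatten [seq [:: L i; B i] | i <- enum 'I_s].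
  have -> : \sum_(i < s) (mu (L i) + mu (B i)) = \sum_(G <- Ls) mu G.
    rewrite /Ls big_flatten big_map big_enum/=; apply: eq_bigr => i _.
    by rewrite big_cons big_seq1.
  have mapLs : [seq unit_supp G | G <- Ls] =
      flatten [seq [:: unit_supp (L i); unit_supp (B i)] | i <- enum 'I_s].
    by rewrite /Ls map_flatten -map_comp.
  have LsP G : G \in Ls -> exists2 i, G \subset A_ i & G = L i \/ G = B i.
    move=> /flattenP[_ /mapP[i _ ->]]; rewrite !inE => /orP[/eqP ->|/eqP ->].
      by exists i; [exact: LA|left].
    by exists i; [exact: BA|right].
  have supp_before (i i' : 'I_s) G G' : (i < i')%N -> G \subset A_ i -> G' \subset A_ i' ->
      before (unit_supp G) (unit_supp G').
    move=> ii' GA GA'; apply/beforeP => _ _ /unit_suppP[k kG ->] /unit_suppP[k' kG' ->].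
    rewrite (block_index_mono hxr) ltnS.
    by apply: (A_lt i i') => //; [exact: (fintype.subsetP GA)|exact: (fintype.subsetP GA')].
  apply: sum_unit_comb_le; first by move=> G /LsP[i GA _]; exact: fintype.subset_trans GA (AA i).
  (* [p] sends the at most two minima that come from index [i] to [kap i]. Such a minimum is r k.+1
     for a block [k] that meets E_i, whence 2 * kap i <= r k.+1, and spreading with c = 2
     applies. *)
  + pose p m := if [pick i | m \in unit_supp (A_ i)] is Some i then kap i else 0%N.
    have pE m i : m \in unit_supp (A_ i) -> p m = kap i.
      move=> mi; rewrite /p; case: pickP => [i' mi'|/(_ i)]; last by rewrite mi.
      congr kap; move: mi mi' => /unit_suppP[k kA ->]; rewrite mem_unit_supp => kA'.
      apply/val_inj; case: (ltngtP (val i) (val i')) => // h.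
        by have := A_lt _ _ _ _ h kA kA'; rewrite ltnn.
      by have := A_lt _ _ _ _ h kA' kA; rewrite ltnn.
    have minsP m : m \in mins [seq G <- [seq unit_supp G | G <- Ls] | G != fset0] ->
        exists i, m \in unit_supp (A_ i) /\
          (m = fmin (unit_supp (L i)) \/ m = fmin (unit_supp (B i))).
      move=> /imfsetP[/= G' + ->]; rewrite mem_filter => /andP[G0 /mapP[G GL GE]].
      have [i GA Gi] := LsP _ GL; exists i; split.
        have [+ _] := fminP G0; rewrite {2}GE => /unit_suppP[k kG ->].
        by rewrite mem_unit_supp; exact: (fintype.subsetP GA).
      by rewrite GE; case: Gi => ->; [left|right].
    apply: (@schreier_iter_spread 2 _ _ _ p) kap_schreier _ _ _ _ => //.
    * move=> m /minsP[i [/pE -> _]]; by apply/imfsetP; exists i.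
    * move=> m /minsP[i [mi _]]; rewrite (pE _ _ mi).
      move: mi => /unit_suppP[k kA ->].
      move: kA; rewrite !inE => /andP[_ /andP[/restr_neq0[m' mE xm'] _]].
      have [_ /(_ _ xm')[_]] := hxr k; apply: leq_trans; rewrite leq_mul2l; exact: kap_le.
    * move=> m m' /minsP[i [mi _]] /minsP[i' [mi' _]] mm'.
      rewrite (pE _ _ mi) (pE _ _ mi') leqNgt; apply/negP => h.
      have ii' : (i' < i)%N.
        rewrite ltnNge leq_eqVlt; apply/negP => /orP[/eqP/val_inj ii|/kap_homo hh].
          by rewrite ii ltnn in h.
        by have := ltn_trans h hh; rewrite ltnn.
      have /beforeP/(_ _ _ mi' mi) := supp_before _ _ _ _ ii' (subxx _) (subxx _); lia.
    * move=> z; have [->|/fset0Pn[m]] := eqVneq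
        [fset m in mins [seq G <- [seq unit_supp G | G <- Ls] | G != fset0] | p m == z]%fset
        fset0; first by rewrite cardfs0.
      rewrite !inE => /andP[/minsP[i [mi _]] /eqP pm]; rewrite (pE _ _ mi) in pm.
      apply: (@leq_trans #|` [fset fmin (unit_supp (L i)); fmin (unit_supp (B i))]%fset|).
        apply: fsubset_leq_card; apply/fsubsetP => m'.
        rewrite !inE => /andP[/minsP[i' [mi' m'E]] /eqP pm']; rewrite (pE _ _ mi') in pm'.
        have <- : i' = i.
          apply/val_inj; case: (ltngtP (val i') (val i)) => // /kap_homo; lia.
        by case: m'E => <-; rewrite eqxx ?orbT.
      by rewrite cardfs2; case: (_ != _).
  + rewrite mapLs; apply: pairwise_flatten2.
      move=> i; apply/beforeP => _ _ /unit_suppP[k kL ->] /unit_suppP[k' kB ->].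
      rewrite (block_index_mono hxr) ltnS.
      move: kL; rewrite inE => /andP[_ /exists_inP[k'' k''A kk'']].
      by apply: leq_trans kk'' _; exact: B_max kB k''A.
    apply: pairwise_enum_ord => i j ij.
    by apply/and4P; split; apply: (supp_before i j) => //.
- rewrite /mass; under eq_bigr do rewrite big_mkcond/=.
  rewrite exchange_big/= [leRHS]big_mkcond/=; apply: ler_sum => k _.
  have [/existsP[i kL]|/existsPn kL] := boolP [exists i, k \in L i]; last first.
    rewrite big1; first by case: ifP.
    by move=> i _; rewrite ifN.
  have kA := fintype.subsetP (LA i) _ kL.
  rewrite (fintype.subsetP (AA i))// (bigD1 i)//= kL big1 ?addr0// => i' i'i.
  rewrite ifN//; apply/negP => /(fintype.subsetP (LA i')).
  move: kA; rewrite !inE => /andP[_ ik] /andP[_ i'k].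
  by rewrite (fst_uniq _ _ _ i'k ik) eqxx in i'i.
Qed.

End Split.

(** * Averages with small auxiliary norm *)

Section NormCard.
Variables (R : realType) (K : Type) (M : K -> set {fset nat}) (theta : K -> R).
Variable N : c00 R -> R.
Hypothesis hN : is_tsirelson_norm M theta N.
Hypothesis theta_gt0 : forall k, 0 < theta k.
Hypothesis theta_half : forall k, theta k <= 2^-1.

(** Each nonzero restriction is charged to a support point in its set, and successive sets are
    disjoint. The bound does not depend on the family; it handles the families whose weight is tiny
    compared with the size of the support. *)
Lemma tsi_card (x : c00 R) s (E : 'I_s -> {fset nat}) :
  (forall i j : 'I_s, (i < j)%N -> before (E i) (E j)) ->
  \sum_(i < s) N (restr (E i) x) <= #|` c00_supp x|%:R * N x.
Proof.
move=> Eb; have Einj m i j : m \in E i -> m \in E j -> i = j.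
  move=> mi mj; apply/val_inj; case: (ltngtP (val i) (val j)) => // h.
    by have /beforeP/(_ _ _ mi mj) := Eb _ _ h; rewrite ltnn.
  by have /beforeP/(_ _ _ mj mi) := Eb _ _ h; rewrite ltnn.
apply: (@le_trans _ _ (\sum_(i < s) \sum_(m <- c00_supp x) (m \in E i)%:R * N x)).
  apply: ler_sum => i _.
  have [->|/restr_neq0[m mE xm]] := eqVneq (restr (E i) x) 0.
    by rewrite (tsi0 hN) sumr_ge0// => m _; rewrite mulr_ge0 ?ler0n// (tsi_ge0 hN).
  rewrite (big_fsetD1 m)/= ?mem_c00_supp// mE mul1r.
  apply: ler_wpDr; last exact: (tsi_restr hN theta_gt0 theta_half).
  by apply: sumr_ge0 => m' _; rewrite mulr_ge0 ?ler0n// (tsi_ge0 hN).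
rewrite exchange_big/= -[#|` _|]sum1_size natr_sum mulr_suml; apply: ler_sum => m _.
rewrite mul1r; have [i mi|mE] := pickP (fun i => m \in E i).
  rewrite (bigD1 i)//= mi mul1r big1 ?addr0// => j ji.
  case: (boolP (m \in E j)) => [mj|]; last by rewrite mul0r.
  by rewrite (Einj _ _ _ mi mj) eqxx in ji.
by rewrite big1 ?(tsi_ge0 hN)// => i _; rewrite mE mul0r.
Qed.

(** At most one set of an admissible family contains [m], so the norm is at most the maximum of 1
    and half of itself. *)
Lemma tsi_unit m : N (c00_unit R m) <= 1.
Proof.
have [->|m0] := posnP m.
  have -> : c00_unit R 0 = 0 by apply: c00_eq => i.
  by rewrite (tsi0 hN).
have supp1 : c00_supp (c00_unit R m) = [fset m]%fset.
  apply/fsetP => i; rewrite mem_c00_supp c00_unitE// inE.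
  by case: (i == m); rewrite ?oner_eq0 ?eqxx.
suff : N (c00_unit R m) <= Num.max 1 (2^-1 * N (c00_unit R m)).
  by rewrite le_max => /orP[//|]; have := tsi_ge0 hN (c00_unit R m); lra.
apply: (tsi_le hN theta_gt0) => [i|k s E ME]; rewrite le_max.
  by rewrite c00_unitE//; case: (i == m); rewrite ?normr0 ?normr1 ?lexx ?ler01.
apply/orP; right; have [k0 [_ kE]] := ME.
have := tsi_card (c00_unit R m) (interlaced_before kE).
rewrite supp1 cardfs1 mul1r => h; apply: ler_pM => //; first exact: ltW.
by apply: sumr_ge0 => i _; exact: tsi_ge0 hN _.
Qed.

End NormCard.

Lemma half_normP (R : realType) n :
  is_tsirelson_norm (fun _ : unit => schreier_iter n) (fun=> 2^-1) (@half_norm R n).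
Proof.
by apply: tsirelson_normP => _; rewrite ?invr_gt0// invf_le1 ?ler1n.
Qed.

Lemma block_sequence_sub (R : realType) (x : nat -> c00 R) r (phi : nat -> nat) :
  {homo phi : i j / (i < j)%N} -> block_sequence x r ->
  block_sequence (x \o phi) (r \o phi).
Proof.
move=> phi_homo hxr k /=; have hr := block_index_homo hxr; split.
  exact/hr/phi_homo.
move=> n /(proj2 (hxr _))[-> h]; split=> //; apply: leq_trans h _.
by rewrite (leq_mono hr); exact: phi_homo.
Qed.

Section Average.
Variables (R : realType) (kk s : nat) (eps : R).
Hypothesis hsmall : small_combinations kk s eps.

Let P := @half_norm R kk.

(** The choice of [s] is applied to the range of [r], and its combination is rewritten along a
    subsequence of [r] with positive coefficients, so that its support is the full set of indices
    used. *)
Lemma decreasing_average (r : nat -> nat) : {homo r : i j / (i < j)%N} ->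
  exists q (phi : nat -> nat) (a : nat -> R),
  [/\ {homo phi : i j / (i < j)%N},
      forall i, 0 <= a i /\ ((i < q)%N -> 0 < a i),
      [/\ forall i, a i.+1 <= a i, a q = 0 & \sum_(i < q) a i = 1],
      schreier_iter s [fset r (phi (val i)) | i : 'I_q]%fset &
      P (\sum_(i < q) a i *: c00_unit R (r (phi i))) < eps].
Proof.
move=> hr; have r_inj : injective r by exact/incn_inj/leq_mono.
have infD : infinite_set (range r).
  move=> fin; apply: infinite_nat.
  have -> : ([set: nat] = r @^-1` range r)%classic by apply/seteqP; split=> // i _; exists i.
  by apply: finite_preimage fin => i j _ _; exact: r_inj.
have [q0 [r0 [a0 [r0_gt0 r0_homo [a0_ge0 a0_sum] a0_homo [suppD suppF Peps]]]]] := hsmall infD.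
have r0_inj : injective r0.
  move=> i j rij; apply/val_inj; case: (ltngtP (val i) (val j)) => // /r0_homo;
    by rewrite rij ltnn.
pose ext (T : Type) (z : T) (f : 'I_q0 -> T) (i : nat) : T := oapp f z (insub i).
have extE T z (f : 'I_q0 -> T) (i : 'I_q0) : ext T z f i = f i by rewrite /ext valK.
have ext_out T z (f : 'I_q0 -> T) i : (q0 <= i)%N -> ext T z f i = z.
  by move=> qi; rewrite /ext insubF//; apply/negbTE; rewrite -leqNgt.
pose a := ext R 0 a0; pose rr := ext nat 0%N r0.
have a_ge0 i : 0 <= a i.
  by rewrite /a /ext; case: insub => //=.
have a_le i j : (i <= j)%N -> a j <= a i.
  move=> ij; case: (ltnP j q0) => [jq|qj]; last by rewrite {1}/a ext_out.
  have iq := leq_ltn_trans ij jq.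
  by rewrite /a (extE _ _ _ (Ordinal iq)) (extE _ _ _ (Ordinal jq)) a0_homo.
have exq : exists i, a i == 0 by exists q0; rewrite /a ext_out.
(* The coefficients decrease, so their zeros form a tail; cutting at the first zero leaves only
   positive ones. *)
pose q := ex_minn exq.
have [aq qmin] : a q = 0 /\ forall i, a i = 0 -> (q <= i)%N.
  by rewrite /q; case: ex_minnP => m /eqP am mi; split=> // i /eqP /mi.
have qq0 : (q <= q0)%N by apply: qmin; rewrite /a ext_out.
have aP i : (i < q)%N -> 0 < a i.
  move=> iq; rewrite lt_neqAle a_ge0 andbT; apply: contraTneq iq => /esym/qmin.
  by rewrite -leqNgt.
have a_out i : (q <= i)%N -> a i = 0.
  by move=> qi; apply/eqP; rewrite eq_le a_ge0 -aq a_le.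
have reindex (V : nmodType) (F : nat -> V) : (forall i, a i = 0 -> F i = 0) ->
    \sum_(i < q0) F i = \sum_(i < q) F i.
  move=> F0; rewrite (big_ord_widen _ F qq0) [RHS]big_mkcond/=.
  by apply: eq_bigr => i _; case: ltnP => // /a_out /F0.
set X := \sum_(i < q0) _ in suppD suppF Peps.
have XE : X = \sum_(i < q) a i *: c00_unit R (rr i).
  rewrite /X -(reindex _ (fun i => a i *: c00_unit R (rr i))); last first.
    by move=> i ->; rewrite scale0r.
  by apply: eq_bigr => i _; rewrite /a /rr !extE.
have Xr0 i : X (r0 i) = a0 i.
  rewrite c00_sum (bigD1 i)// big1 => [|j /andP[_ ji]].
    by rewrite c00Z c00_unitE// eqxx mulr1 /= addr0.
  rewrite c00Z c00_unitE//; case: eqP => [/r0_inj ij|]; last by rewrite mulr0.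
  by rewrite ij eqxx in ji.
have Xsupp m : m \in c00_supp X -> exists2 i : 'I_q, m = rr i & True.
  rewrite mem_c00_supp => Xm.
  apply: contrapT => nex; move/eqP: Xm; apply; rewrite XE c00_sum big1// => i _.
  have iq0 := leq_trans (ltn_ord i) qq0.
  rewrite c00Z c00_unitE; last by rewrite /rr (extE _ _ _ (Ordinal iq0)).
  by case: eqP => [mi|]; rewrite ?mulr0//; case: nex; exists i.
have suppX (i : 'I_q) : rr i \in c00_supp X.
  have iq0 := leq_trans (ltn_ord i) qq0.
  rewrite mem_c00_supp /rr (extE _ _ _ (Ordinal iq0)) Xr0.
  by have := aP i (ltn_ord i); rewrite /a (extE _ _ _ (Ordinal iq0)) => /gt_eqF ->.
have /choice[psi psiE] i : exists j, (i < q)%N -> r j = rr i.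
  case: (ltnP i q) => [iq|]; last by exists 0%N.
  by have [j _ <-] := suppD _ (suppX (Ordinal iq)); exists j.
(* Only the values of [phi] below [q] matter for the sums; beyond, the offset [B] keeps [phi]
   strictly increasing. *)
pose B := (\max_(i < q) psi i).+1.
pose phi i := if (i < q)%N then psi i else (B + i)%N.
have phi_homo : {homo phi : i j / (i < j)%N}.
  apply: homo_ltn => [i j k|i]; first exact: ltn_trans.
  rewrite /phi; case: (ltnP i.+1 q) => [iq|_].
    rewrite (ltnW iq) -(leqW_mono (leq_mono hr)) !psiE//; last exact: ltnW.
    have i1 := leq_trans iq qq0; have i0 := ltnW i1.
    rewrite /rr (extE _ _ _ (Ordinal i0)) (extE _ _ _ (Ordinal i1)).
    exact: r0_homo.
  case: (ltnP i q) => iq; last by rewrite ltn_add2l.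
  have : (psi i <= \max_(i < q) psi i)%N by exact: (leq_bigmax (Ordinal iq)).
  rewrite /B; lia.
have rphi (i : 'I_q) : r (phi i) = rr i by rewrite /phi ltn_ord psiE.
exists q, phi, a; split=> //.
- by move=> i; split=> //; exact: aP.
- split=> [i||]; [exact: a_le|by []|]; rewrite -(reindex _ a)//; rewrite -a0_sum.
  by apply: eq_bigr => i _; rewrite /a extE.
- rewrite (_ : [fset _ | i : 'I_q]%fset = c00_supp X)//; apply/fsetP => m.
  apply/imfsetP/idP => [[i _ ->]|/Xsupp[i -> _]]; first by rewrite rphi.
  by exists i; rewrite ?rphi.
- under eq_bigr do rewrite rphi.
  by rewrite -XE.
Qed.

(** [unit_comb] puts the coefficient a_i at position i+1, while the small combination X puts it at
    position i. The shifted vector is X without its first term plus the sum of (a_i - a_{i+1})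
    e_{i+1} along the chosen positions. As the coefficients decrease to 0, the second sum telescopes
    to norm at most a_0, and a_0 <= |X|; hence the factor 3. *)
Lemma block_average (x : nat -> c00 R) r : block_sequence x r -> (0 < r 0)%N ->
  exists q (phi : nat -> nat) (a : nat -> R),
  [/\ {homo phi : i j / (i < j)%N},
      forall i, 0 <= a i /\ ((i < q)%N -> 0 < a i),
      \sum_(i < q) a i = 1,
      schreier_iter s [fset r (phi (val i)) | i : 'I_q]%fset &
      P (unit_comb (r \o phi) a [set: 'I_q]) <= 3 * eps].
Proof.
move=> hxr r0; have hr := block_index_homo hxr.
have [q [phi [a [hphi a0 [a_le aq a1] sF Peps]]]] := decreasing_average hr.
exists q, phi, a; split => //.
have hP := half_normP R kk.
have h0 (u : unit) : 0 < (2^-1 : R) by rewrite invr_gt0.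
have hh (u : unit) : (2^-1 : R) <= 2^-1 by [].
pose rho i := r (phi i).
have rho_inj : injective rho.
  by move=> i j /(block_index_inj hxr); apply: incn_inj; exact: leq_mono.
have rho_gt0 i : (0 < rho i)%N by apply: leq_trans r0 _; rewrite (leq_mono hr).
set X := \sum_(i < q) _ in Peps.
have q0 : (0 < q)%N.
  by case: (q) a1 => // /eqP; rewrite big_ord0 eq_sym oner_eq0.
have aPX : a 0%N <= P X.
  apply: le_trans (tsi_coord hP _ (rho 0%N)).
  rewrite c00_sum (bigD1 (Ordinal q0))// big1 => [|k /andP[_ k0]].
    by rewrite c00Z c00_unitE ?rho_gt0// eqxx mulr1 /= addr0 ger0_norm// (a0 0%N).1.
  rewrite c00Z c00_unitE ?rho_gt0//; case: eqP => [/rho_inj kE|]; last by rewrite mulr0.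
  by case/eqP: k0; apply/val_inj.
have -> : unit_comb (r \o phi) a [set: 'I_q] =
    (X - a 0%N *: c00_unit R (rho 0%N)) +
    \sum_(i < q) (a i - a i.+1) *: c00_unit R (rho i.+1).
  have -> : X - a 0%N *: c00_unit R (rho 0%N) =
      \sum_(i < q) a i.+1 *: c00_unit R (rho i.+1).
    have <- : \sum_(i < q.+1) a i *: c00_unit R (rho i) = X.
      by rewrite big_ord_recr/= aq scale0r addr0.
    by rewrite big_ord_recl/= addrAC subrr add0r.
  rewrite -big_split/=; apply: eq_big => i; first by rewrite inE.
  by move=> _; rewrite -scalerDl addrC subrK.
apply: le_trans (tsiD hP _ _) _.
have h1 : P (X - a 0%N *: c00_unit R (rho 0%N)) <= P X + a 0%N.
  apply: le_trans (tsiD hP _ _) _; rewrite lerD2l -scaleNr (tsiZ hP) normrN.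
  rewrite ger0_norm ?(a0 0%N).1// -[leRHS]mulr1 ler_wpM2l ?(a0 0%N).1//.
  exact: (tsi_unit hP h0 hh).
have h2 : P (\sum_(i < q) (a i - a i.+1) *: c00_unit R (rho i.+1)) <= a 0%N.
  apply: le_trans (tsi_sum hP _ _ _) _.
  apply: (@le_trans _ _ (\sum_(i < q) (a i - a i.+1))).
    apply: ler_sum => i _; rewrite (tsiZ hP) ger0_norm ?subr_ge0//.
    rewrite -[leRHS]mulr1 ler_wpM2l ?subr_ge0//; exact: (tsi_unit hP h0 hh).
  rewrite -(big_mkord xpredT (fun i => a i - a i.+1)).
  rewrite (eq_bigr (fun i => - (a i.+1 - a i))); last by move=> i _; rewrite opprB.
  by rewrite sumrN telescope_sumr// aq opprB subr0.
apply: le_trans (lerD h1 h2) _.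
have -> : 3 * eps = eps + (eps + eps) by rewrite mulr_natl.
have a0e : a 0%N <= eps := le_trans aPX (ltW Peps).
by rewrite -addrA !lerD// ltW.
Qed.

End Average.

(** * Consequences of the choice of the families *)

Lemma pairwise_flatten (T : eqType) (I : Type) (e : rel T) (F : I -> seq T) (t : seq I) :
  (forall i, pairwise e (F i)) -> pairwise (fun i j => allrel e (F i) (F j)) t ->
  pairwise e (flatten [seq F i | i <- t]).
Proof.
move=> eF; elim: t => //= i t IH /andP[it /IH et].
rewrite pairwise_cat eF et !andbT; apply/allrelP => u v uF /flattenP[w].
elim: t it {IH et} => //= j t IH /andP[ij it]; rewrite inE => /orP[/eqP -> vF|].
  by move/allrelP: ij; apply.
exact: IH.
Qed.

(** Sending the point of each singleton to its integer [k i] is a spreading with c = 1. *)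
Lemma family_prod_schreier_iter n :
  (family_prod (schreier_iter n.+1) (schreier_iter 0) `<=` schreier_iter n.+1)%classic.
Proof.
move=> F [s [E [E1 [k [kF kE] FE]]]].
have [_ kle _] := kE; have kb := interlaced_before kE.
pose p x := if [pick i | x \in E i] is Some i then k i else 0%N.
have pE x i : x \in E i -> p x = k i.
  move=> xi; rewrite /p; case: pickP => [j xj|/(_ i)]; last by rewrite xi.
  congr k; apply/val_inj; case: (ltngtP (val j) (val i)) => // h.
    by have /beforeP/(_ _ _ xj xi) := kb _ _ h; rewrite ltnn.
  by have /beforeP/(_ _ _ xi xj) := kb _ _ h; rewrite ltnn.
have FP x : x \in F -> exists i, x \in E i by rewrite FE => /mem_bigfsetU_ord.
apply: (@schreier_iter_spread 1 _ _ _ p) kF _ _ _ _ => //.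
- by move=> x /FP[i /pE ->]; apply/imfsetP; exists i.
- by move=> x /FP[i xi]; rewrite (pE _ _ xi) mul1n; exact: kle.
- move=> x y /FP[i xi] /FP[j yj] xy; rewrite (pE _ _ xi) (pE _ _ yj).
  case: (ltngtP (val i) (val j)) => [/(interlaced_mono kE)/ltnW//|h|/val_inj -> //].
  have /beforeP/(_ _ _ yj xi) := kb _ _ h; lia.
- move=> y; have [->|/fset0Pn[x]] := eqVneq [fset x in F | p x == y]%fset fset0.
    by rewrite cardfs0.
  rewrite !inE => /andP[/FP[i xi] /eqP px].
  have [z _ Ez] := E1 i; apply: (@leq_trans #|` E i|); last by rewrite Ez cardfs1.
  apply: fsubset_leq_card; apply/fsubsetP => x'.
  rewrite !inE => /andP[/FP[j xj] /eqP px'].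
  suff -> : i = j by [].
  by apply: (interlaced_inj kE); rewrite -(pE _ _ xi) -(pE _ _ xj) px px'.
Qed.

Definition c00_bound (R : realType) (x : c00 R) : nat := (\max_(i <- c00_supp x) i)%N.

Lemma c00_boundP (R : realType) (x : c00 R) n : x n != 0 -> (n <= c00_bound x)%N.
Proof.
by rewrite -mem_c00_supp => nx; rewrite /c00_bound (big_fsetD1 n)//= leq_maxl.
Qed.

(** Used to build block sequences: [h] measures how far the next index must lie so that the new
    block suits the one just chosen. *)
Lemma dependent_sequence (T : Type) (Q : nat -> T -> Prop) (h : T -> nat) (N0 : nat) :
  (forall n, (N0 <= n)%N -> exists x, Q n x) ->
  exists (r : nat -> nat) (x : nat -> T), r 0%N = N0 /\
    forall i, [/\ (N0 <= r i)%N, Q (r i) (x i), (h (x i) <= r i.+1)%N & (r i < r i.+1)%N].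
Proof.
move=> hQ; have [x0 _] := hQ N0 (leqnn _).
have /choice[g gQ] n : exists x, (N0 <= n)%N -> Q n x.
  by case: (leqP N0 n) => [/hQ[x Qx]|_]; [exists x|exists x0].
pose r := fix r i := if i is i'.+1 then maxn (h (g (r i'))) (r i').+1 else N0.
have rN0 i : (N0 <= r i)%N by elim: i => //= i IH; lia.
exists r, (g \o r); split=> // i; split=> //=; [exact: gQ|lia|lia].
Qed.

Section AdmissibleChoice.
Variables (R : realType) (m k s l : nat -> nat).
Hypothesis hc : admissible_choice R m k s l.

Lemma weight_gt1 j : (1 < m j)%N.
Proof.
have [m0 mS _ _ _ _ _] := hc; elim: j => [|j IH]; first by rewrite m0.
apply: leq_trans (mS j); apply: (@leq_trans (m j).+1); first exact: leqW.
by rewrite ltnS -{1}[m j]expn1 leq_exp2l//; exact: ltnW.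
Qed.

Lemma weight_homo : {homo m : i j / (i < j)%N}.
Proof.
apply: homo_ltn => [i j p|j]; first exact: ltn_trans.
have [_ mS _ _ _ _ _] := hc; apply: leq_ltn_trans (mS j).
by rewrite -{1}[m j]expn1 leq_exp2l ?weight_gt1//; exact/ltnW/weight_gt1.
Qed.

Lemma weight_ge j : (j + 2 <= m j)%N.
Proof.
elim: j => [|j IH]; first exact: weight_gt1.
by rewrite addSn; apply: leq_ltn_trans IH (weight_homo (ltnSn j)).
Qed.

Lemma weight_le i j : (i <= j)%N -> (m i <= m j)%N.
Proof. by rewrite (leq_mono weight_homo). Qed.

Let theta j : R := (m j)%:R^-1.

Lemma theta_gt0 j : 0 < theta j.
Proof. by rewrite invr_gt0 ltr0n; exact/ltnW/weight_gt1. Qed.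

Lemma theta_half j : theta j <= 2^-1.
Proof. by rewrite lef_pV2 ?posrE ?ltr0n ?ler_nat ?weight_gt1//; exact/ltnW/weight_gt1. Qed.

Lemma mixed_normP : is_tsirelson_norm (mixed_family s l) theta
  (tsirelson_norm (mixed_family s l) theta).
Proof.
apply: tsirelson_normP => j; first exact: theta_gt0.
by apply: le_trans (theta_half j) _; rewrite invf_le1 ?ler1n.
Qed.

Lemma mixed_family_sub i j : (i <= j)%N ->
  (mixed_family s l i `<=` schreier_iter (k j))%classic.
Proof.
have [_ _ sub_k k_sub _ _ _] := hc.
elim: j => [|j IH]; first by rewrite leqn0 => /eqP ->; exact: sub_k.
rewrite leq_eqVlt => /orP[/eqP ->|]; first exact: sub_k.
by rewrite ltnS => /IH ij F /ij /k_sub /sub_k.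
Qed.

(** The empty set belongs to [mixed_family s l 0] but not to [schreier_iter 0]. This gives the index
    the form [n.+1] needed for spreading. *)
Lemma schreier_index_gt0 j : (0 < k j)%N.
Proof.
have := @mixed_family_sub 0 j (leq0n _); case: (k j) => // sub.
have /sub[i _ /fsetP/(_ i)] : mixed_family s l 0 fset0 by apply: schreier_iter1.
by rewrite !inE eqxx.
Qed.

Lemma power_gt j : (2 * m j.+1 < 2 ^ l j.+1)%N.
Proof.
have [_ _ _ _ _ _ /(_ j)] := hc.
rewrite ltf_pV2 ?posrE ?exprn_gt0 ?mulr_gt0 ?ltr0n//; last exact: ltnW (weight_gt1 _).
by rewrite -natrX -natrM ltr_nat.
Qed.

Lemma power_index_gt0 j : (0 < l j.+1)%N.
Proof. by have := power_gt j; have := weight_gt1 j.+1; case: (l j.+1) => //=; lia. Qed.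

Lemma schreier_sub_mixed j : (schreier_iter (s j.+1) `<=` mixed_family s l j.+1)%classic.
Proof.
rewrite /mixed_family /family_power; elim: (l j.+1).-1 => //= p IH.
apply: schreier_iter_sub_prod => x x0; exact/IH/schreier_iter_single.
Qed.

Lemma mixed_family_single j x : (0 < x)%N -> mixed_family s l j [fset x]%fset.
Proof.
move=> x0; case: j => [|j]; first exact: schreier_iter_single.
exact/schreier_sub_mixed/schreier_iter_single.
Qed.

(** Averaging [l j.+1] times from single vectors produces a product ending in singletons; the
    innermost factor absorbs them. *)
Lemma iter_prod_sub_mixed j :
  (iter (l j.+1) (family_prod (schreier_iter (s j.+1))) (schreier_iter 0)
     `<=` mixed_family s l j.+1)%classic.
Proof.
have [_ _ _ _ s_gt _ _] := hc.
have s0 : (0 < s j.+1)%N by apply: leq_ltn_trans (s_gt j).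
rewrite /mixed_family /family_power -(prednK (power_index_gt0 j)) -pred_Sn iterSr.
elim: (l j.+1).-1 => [|p IH] /=; last exact: family_prod_subr.
by rewrite -(prednK s0); exact: family_prod_schreier_iter.
Qed.

End AdmissibleChoice.

(** * Flat blocks *)

Section James.
Variables (R : realType) (m k s l : nat -> nat).
Hypothesis hc : admissible_choice R m k s l.

Let theta j : R := (m j)%:R^-1.
Let N : c00 R -> R := tsirelson_norm (mixed_family s l) theta.
Let hN : is_tsirelson_norm (mixed_family s l) theta N := mixed_normP hc.
Let th0 : forall j, 0 < theta j := theta_gt0 hc.
Let thh : forall j, theta j <= 2^-1 := theta_half hc.

Definition supp_ge (u : c00 R) (n : nat) := forall i, u i != 0 -> (n <= i)%N.

(* [near u e] stands for: u is within distance e of a fixed subspace. *)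
Variable near : c00 R -> R -> Prop.
Hypothesis near0 : near 0 0.
Hypothesis nearD : forall u v d e, near u d -> near v e -> near (u + v) (d + e).
Hypothesis nearZ : forall a u e, near u e -> near (a *: u) (`|a| * e).
Hypothesis near_le : forall u d e, d <= e -> near u d -> near u e.
Hypothesis near_block : forall n e, 0 < e ->
  exists u, [/\ supp_ge u n, N u = 1 & near u e].

Lemma near_sum (q : nat) (A : {set 'I_q}) (a : nat -> R) (x : nat -> c00 R) e :
  (forall i, 0 <= a i) -> (forall i, near (x i) e) ->
  near (block_comb x a A) ((\sum_(i in A) a i) * e).
Proof.
move=> a0 xe; rewrite mulr_suml /block_comb.
elim/big_rec2 : _ => // i u v _ uv; apply: nearD => //.
by have := nearZ (a i) (xe i); rewrite ger0_norm.
Qed.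

Lemma near_average (q : nat) (a : nat -> R) (x : nat -> c00 R) e :
  (forall i, 0 <= a i) -> \sum_(i < q) a i = 1 -> (forall i, near (x i) e) ->
  near (block_comb x a [set: 'I_q]) e.
Proof.
move=> a0 a1 /(near_sum [set: 'I_q] a0).
have -> : \sum_(i in [set: 'I_q]) a i = 1 by rewrite -a1; apply: eq_bigl => i; rewrite inE.
by rewrite mul1r.
Qed.

Lemma norm_adm_le j (u : c00 R) t (E : 'I_t -> {fset nat}) :
  admissible (mixed_family s l j) E -> \sum_(i < t) N (restr (E i) u) <= (m j)%:R * N u.
Proof.
move=> /(tsi_adm hN th0 u); rewrite /theta mulrC ler_pdivrMr 1?mulrC//.
by rewrite ltr0n; exact/ltnW/(weight_gt1 hc).
Qed.

(** The bound 4 is the bound 2 of [sum_adm_block_average] divided by a norm greater than 1/2. *)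
Definition flat (n : nat) (u : c00 R) := forall j t (E : 'I_t -> {fset nat}),
  (j < n)%N -> admissible (mixed_family s l j) E ->
  \sum_(i < t) N (restr (E i) u) <= 4.

Lemma block_comb_coord q (A : {set 'I_q}) (x : nat -> c00 R) r a (k0 : 'I_q) i : block_sequence x r ->
  k0 \in A -> x (val k0) i != 0 -> block_comb x a A i = a k0 * x k0 i.
Proof.
move=> hxr kA xi; rewrite c00_sum (bigD1 k0)// big1 => [|k' /andP[_ k'k]].
  by rewrite /= addr0.
rewrite c00Z; have [->|xi'] := eqVneq (x k' i) 0; first by rewrite mulr0.
case: (ltngtP (val k') (val k0)) => [h|h|/val_inj kk].
- by have := block_lt hxr h xi' xi; rewrite ltnn.
- by have := block_lt hxr h xi xi'; rewrite ltnn.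
- by rewrite kk eqxx in k'k.
Qed.

Lemma block_comb_eq0 q (A : {set 'I_q}) (x : nat -> c00 R) a i :
  (forall k0, k0 \in A -> x (val k0) i = 0) -> block_comb x a A i = 0.
Proof. by move=> h; rewrite c00_sum big1// => k0 /h xi; rewrite c00Z xi mulr0. Qed.

Lemma restr_block_comb q (A : {set 'I_q}) (x : nat -> c00 R) r a (k0 : 'I_q) G : block_sequence x r ->
  k0 \in A -> (forall i, i \in G -> x (val k0) i != 0) ->
  restr G (block_comb x a A) = a k0 *: restr G (x k0).
Proof.
move=> hxr kA hG; apply: c00_eq => i; rewrite c00Z !restrE.
by case: ifP => [/hG xi|_]; [exact: block_comb_coord hxr kA xi|rewrite mulr0].
Qed.

Lemma norm_block_comb_le q (A : {set 'I_q}) (x : nat -> c00 R) a :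
  (forall i, 0 <= a i) -> (forall i, N (x i) = 1) ->
  N (block_comb x a A) <= \sum_(i in A) a i.
Proof.
move=> a0 x1; apply: le_trans (tsi_sum hN _ _ _) _; apply: ler_sum => i _.
by rewrite (tsiZ hN) x1 mulr1 ger0_norm.
Qed.

Section BlockAverage.
Variables (j : nat) (x : nat -> c00 R) (r : nat -> nat) (a : nat -> R) (q : nat).
Hypothesis hxr : block_sequence x r.
Hypothesis x1 : forall i, N (x i) = 1.
Hypothesis a0 : forall i, 0 <= a i.
Hypothesis a1 : \sum_(i < q) a i = 1.
Hypothesis sF : schreier_iter (s j.+1) [fset r (val i) | i : 'I_q]%fset.

Let y := block_comb x a [set: 'I_q].

Let supp_neq0 i : c00_supp (x i) != fset0.
Proof.
have /c00_neq0[n xn] : x i != 0.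
  by apply/eqP => xi; have := x1 i; rewrite xi (tsi0 hN) => /esym/eqP; rewrite oner_eq0.
by apply/fset0Pn; exists n; rewrite mem_c00_supp.
Qed.

Let interlaced_supp :
  interlaced (fun i : 'I_q => r (val i)) (fun i => c00_supp (x (val i))).
Proof.
split=> // [i n|i i' ii' n]; rewrite mem_c00_supp => xn.
  by have [_ /(_ _ xn)[]] := hxr i.
have n0 : (0 < n)%N by case: n xn => //; rewrite c00P eqxx.
have [_ /(_ _ xn)[_ h]] := hxr i; have -> : val i' = i.+1 by []; lia.
Qed.

Lemma supp_admissible :
  admissible (schreier_iter (s j.+1)) (fun i : 'I_q => c00_supp (x (val i))).
Proof. by exists (fun i => r (val i)). Qed.

Lemma sum_supp_block_average :
  \sum_(i < q) N (restr (c00_supp (x (val i))) y) = 1.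
Proof.
rewrite -a1; apply: eq_bigr => i _.
rewrite (restr_block_comb a hxr (k0 := i)) ?inE//; last by move=> n; rewrite mem_c00_supp.
rewrite (tsiZ hN) ger0_norm// restr_id; last by move=> n; rewrite mem_c00_supp.
by rewrite x1 mulr1.
Qed.

Lemma norm_block_average_ge : (m j.+1)%:R^-1 <= N y.
Proof.
have adm : admissible (mixed_family s l j.+1) (fun i : 'I_q => c00_supp (x (val i))).
  have [k0 [Mk hk]] := supp_admissible; exists k0; split=> //.
  exact: schreier_sub_mixed Mk.
by have := tsi_adm hN th0 y adm; rewrite sum_supp_block_average mulr1.
Qed.

Hypothesis hP : half_norm (k j) (unit_comb r a [set: 'I_q]) <= 3 * ((m j.+2)%:R ^+ 4)^-1.

(** One splitting suffices, with the crude constant c = m_i, valid for any normalized block. The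
    parts lying in a single set contribute at most the total mass 1 by the triangle inequality. The
    spilling blocks contribute at most m_i * e with e <= 6 / m_{j+2}^4, again at most 1. *)
Lemma sum_adm_block_average i t (E : 'I_t -> {fset nat}) : (i <= j)%N ->
  admissible (mixed_family s l i) E -> \sum_(i' < t) N (restr (E i') y) <= 2.
Proof.
move=> ij ME; have [kap [Mkap hE]] := ME; have [_ kle _] := hE.
have q0 : [set: 'I_q] != finset.set0.
  apply/finset.set0Pn; case: (q) a1 => [|q' _]; last by exists ord0; rewrite inE.
  by move=> /eqP; rewrite big_ord0 eq_sym oner_eq0.
have kF := mixed_family_sub hc ij Mkap.
have kk := prednK (schreier_index_gt0 hc j); rewrite -kk in kF.
have hPn := half_normP R (k j); rewrite -[X in schreier_iter X]kk in hPn.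
have [|L [e [_ le1 le2 le3]]] := split_block_comb hPn hxr a0 hN kF
  (interlaced_mono hE) kle (interlaced_before hE) (c := (m i)%:R) q0.
  by move=> k0 _; apply: le_trans (norm_adm_le _ ME) _; rewrite x1 mulr1.
apply: le_trans le1 _.
have h1 : \sum_(i' < t) N (restr (E i') (block_comb x a (L i'))) <= 1.
  rewrite -a1 (_ : \sum_(i0 < q) a i0 = \sum_(i0 in [set: 'I_q]) a i0); last first.
    by apply: eq_bigl => i0; rewrite inE.
  apply: le_trans le3; apply: ler_sum => i' _.
  apply: le_trans (tsi_restr hN th0 thh _ _) _; exact: norm_block_comb_le.
have h2 : e <= 6 * ((m j.+2)%:R ^+ 4)^-1.
  have h : 0 <= \sum_(i' < t) half_norm (k j) (unit_comb r a (L i')).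
    by apply: sumr_ge0 => i' _; exact: tsi_ge0 (half_normP R (k j)) _.
  have {}le2 : \sum_(i' < t) half_norm (k j) (unit_comb r a (L i')) + e <=
    2 * half_norm (k j) (unit_comb r a [set: 'I_q]) := le2.
  move: (\sum_(i' < t) _) h le2 => S h le2.
  move: (half_norm _ _) hP le2 => T hT le2.
  move: (_ ^-1) hT => z hT; lra.
have h3 : (m i)%:R * e <= 1.
  apply: le_trans (ler_wpM2l (ler0n _ _) h2) _.
  rewrite mulrA ler_pdivrMr ?exprn_gt0 ?ltr0n ?(ltnW (weight_gt1 hc _))// mul1r.
  rewrite -natrM -natrX ler_nat.
  have M4 : (4 <= m j.+2)%N by apply: leq_trans (weight_ge hc j.+2); rewrite addnC.
  have iM : (m i <= m j.+2)%N by apply: (weight_le hc); lia.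
  apply: (@leq_trans (m j.+2 * 4 ^ 3)); first by apply: leq_mul.
  by rewrite [leqRHS]expnS leq_mul2l leq_exp2r// M4 orbT.
by have := lerD h1 h3; lra.
Qed.

End BlockAverage.

(** A record of [p] rounds of averaging: the pieces of [v] have total norm at least 2^p and form a
    family of the p-fold product. The pieces stay inside the support so that those of successive
    blocks remain successive. *)
Definition ell1_witness j p (v : c00 R) (L : seq {fset nat}) :=
  [/\ fset0 \notin L, forall G, G \in L -> forall i, i \in G -> v i != 0,
      pairwise before L,
      iter p (family_prod (schreier_iter (s j.+1))) (schreier_iter 0) (mins L) &
      2 ^+ p <= \sum_(G <- L) N (restr G v)].

Lemma mem_mins L n : n \in mins L -> fset0 \notin L -> exists2 G, G \in L & n \in G.
Proof.
move=> /imfsetP[/= G GL ->] L0; exists G => //.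
by apply: (fminP _).1; apply: contraNneq L0 => <-.
Qed.

(** The lists of pieces are concatenated. Convexity of the coefficients preserves the bound 2^p, and
    dividing by N y <= 1/2 doubles it; the indices of the blocks supply the additional product.
    Positivity of the coefficients keeps the pieces inside the support of the average. *)
Lemma ell1_witness_average j p (x : nat -> c00 R) r a q (F : nat -> seq {fset nat}) :
  block_sequence x r -> (forall i, 0 <= a i /\ ((i < q)%N -> 0 < a i)) ->
  \sum_(i < q) a i = 1 ->
  schreier_iter (s j.+1) [fset r (val i) | i : 'I_q]%fset ->
  (forall i, ell1_witness j p (x i) (F i)) ->
  let y := block_comb x a [set: 'I_q] in 0 < N y <= 2^-1 ->
  ell1_witness j p.+1 ((N y)^-1 *: y) (flatten [seq F (val i) | i <- enum 'I_q]).
Proof.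
move=> hxr a0 a1 sF hF y /andP[y0 yhalf].
have F_supp i G : G \in F i -> forall n, n \in G -> x i n != 0.
  by have [_ + _ _ _] := hF i; exact.
have F0 i : fset0 \notin F i by have [] := hF i.
have FP G : G \in flatten [seq F (val i) | i <- enum 'I_q] -> exists i : 'I_q, G \in F i.
  by move=> /flattenP[_ /mapP[i _ ->] GF]; exists i.
split.
- by apply/negP => /FP[i]; apply/negP.
- move=> G /FP[i GF] n nG; have xn := F_supp _ _ GF _ nG.
  rewrite c00Z (block_comb_coord a hxr (k0 := i)) ?inE//.
  by rewrite !mulf_neq0 ?invr_neq0// ?gt_eqF// (a0 i).2.
- apply: (pairwise_flatten (F := fun i : 'I_q => F (val i))) => [i|]; first by have [] := hF i.
  apply: pairwise_enum_ord => i i' ii'; apply/allrelP => G G' GF GF'.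
  apply/beforeP => n n' nG nG'.
  have xn := F_supp _ _ GF _ nG; have xn' := F_supp _ _ GF' _ nG'.
  exact: (@block_lt _ _ _ hxr _ _ _ _ ii' xn xn').
- exists q, (fun i : 'I_q => mins (F (val i))); split.
  + by move=> i; have [] := hF i.
  + exists (fun i => r (val i)); split=> //.
    have F_in i n : n \in mins (F i) -> x i n != 0.
      by move=> /mem_mins/(_ (F0 i))[G /F_supp]; exact.
    split.
    * move=> i; have [_ _ _ _] := hF i; case: (F i) (F0 i) => [|G L _ _].
        by rewrite big_nil leNgt exprn_gt0.
      by apply/fset0Pn; exists (fmin G); apply/imfsetP; exists G; rewrite //= inE eqxx.
    * by move=> i n /F_in xn; have [_ /(_ _ xn)[]] := hxr i.
    * move=> i i' ii' n /F_in xn.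
      have n0 : (0 < n)%N by case: n xn => //; rewrite c00P eqxx.
      have [_ /(_ _ xn)[_ h]] := hxr i; have -> : val i' = i.+1 by []; lia.
  + apply/fsetP => n; apply/idP/idP.
      move=> /imfsetP[/= G /FP[i GF] ->]; apply/mem_bigfsetU_ord; exists i.
      by apply/imfsetP; exists G.
    move=> /mem_bigfsetU_ord[i /imfsetP[/= G GF ->]]; apply/imfsetP; exists G => //=.
    by apply/flattenP; exists (F i) => //; apply/mapP; exists i; rewrite ?mem_enum.
- rewrite big_flatten big_map big_enum/=.
  have -> : \sum_(i < q) \sum_(G <- F i) N (restr G ((N y)^-1 *: y)) =
      \sum_(i < q) (N y)^-1 * (a i * \sum_(G <- F i) N (restr G (x i))).
    apply: eq_bigr => i _; rewrite !mulr_sumr; apply: eq_big_seq => G GF.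
    rewrite restrZ (tsiZ hN) gtr0_norm ?invr_gt0//.
    rewrite (restr_block_comb a hxr (k0 := i)) ?inE//; last exact: F_supp.
    by rewrite (tsiZ hN) ger0_norm// (a0 i).1.
  rewrite -mulr_sumr exprS; apply: ler_pM; rewrite ?exprn_ge0//.
    by rewrite -[2]invrK lef_pV2 ?posrE ?invr_gt0.
  rewrite (_ : 2 ^+ p = \sum_(i < q) a i * 2 ^+ p); last by rewrite -mulr_suml a1 mul1r.
  apply: ler_sum => i _; rewrite ler_wpM2l ?(a0 i).1//.
  by have [_ _ _ _] := hF i.
Qed.

(** A normalized average of norm greater than 1/2 is flat. If none exists, every average has norm at
    most 1/2 and the witnesses can be iterated; for this the claim ranges over all tails and all
    smaller errors. *)
Lemma flat_block j N0 eps : 0 < eps ->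
  exists v, [/\ supp_ge v N0, N v = 1, near v eps & flat j.+1 v].
Proof.
move=> eps0; apply: contrapT => noflat.
have claim p : forall N1 d, (N0 <= N1)%N -> 0 < d <= eps ->
    exists v, [/\ supp_ge v N1, N v = 1, near v d & exists L, ell1_witness j p v L].
  elim: p => [|p IH] N1 d N01 /andP[d0 deps].
    have [v [vN1 v1 vd]] := near_block N1 d0.
    have supp0 : c00_supp v != fset0.
      have /c00_neq0[n vn] : v != 0.
        by apply/eqP => v0; move: v1; rewrite v0 (tsi0 hN) => /esym/eqP; rewrite oner_eq0.
      by apply/fset0Pn; exists n; rewrite mem_c00_supp.
    exists v; split=> //; exists [:: c00_supp v]; split=> //.
    - by rewrite inE eq_sym.
    - by move=> G; rewrite inE => /eqP -> i; rewrite mem_c00_supp.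
    - exists (fmin (c00_supp v)).
        have [+ _] := fminP supp0; rewrite mem_c00_supp.
        by case: (fmin _) => //; rewrite c00P eqxx.
      apply/fsetP => n; rewrite inE; apply/imfsetP/eqP => [[G /=]|->].
        by rewrite inE => /eqP -> ->.
      by exists (c00_supp v); rewrite //= inE.
    - by rewrite big_seq1 restr_id ?v1// => n; rewrite mem_c00_supp.
  have mj0 : (0 : R) < (m j.+1)%:R by rewrite ltr0n; exact/ltnW/(weight_gt1 hc).
  (* The average has norm at least 1 / m_{j+1}, so its normalization multiplies the error by at most
     m_{j+1}. *)
  have d'0 : 0 < d / (m j.+1)%:R <= eps.
    rewrite divr_gt0//= ler_pdivrMr//; apply: le_trans deps _.
    by apply: ler_peMr; [exact: ltW|rewrite ler1n; exact/ltnW/(weight_gt1 hc)].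
  pose Q n v := [/\ supp_ge v n, N v = 1, near v (d / (m j.+1)%:R) &
    exists L, ell1_witness j p v L].
  have [n Nn|r [x [r0 hrx]]] := @dependent_sequence _ Q (fun v => 2 * c00_bound v)%N N1.+1.
    by apply: IH => //; apply: leq_trans Nn; exact: leqW.
  have rN1 i : (N1 < r i)%N by have [] := hrx i.
  have hxr : block_sequence x r.
    move=> i; have [_ [xsupp _ _ _] h rr] := hrx i; split=> // n xn; split; first exact: xsupp.
    by apply: leq_trans h; rewrite leq_mul2l c00_boundP.
  have /choice[F hF] i : exists L, ell1_witness j p (x i) L by have [_ []] := hrx i.
  have [_ _ _ _ _ /(_ j) small _] := hc.
  have [|q [phi [a [hphi a0 a1 sF hP]]]] := block_average small hxr.
    by rewrite r0.
  have hxr' := block_sequence_sub hphi hxr.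
  have x1 i : N ((x \o phi) i) = 1 by have [_ []] := hrx (phi i).
  have ap i : 0 <= a i := (a0 i).1.
  set y := block_comb (x \o phi) a [set: 'I_q].
  have yge : (m j.+1)%:R^-1 <= N y by apply: norm_block_average_ge hxr' x1 ap a1 sF.
  have y0 : 0 < N y by apply: lt_le_trans yge; rewrite invr_gt0.
  pose v := (N y)^-1 *: y.
  have v1 : N v = 1 by rewrite (tsiZ hN) gtr0_norm ?invr_gt0// mulVf// gt_eqF.
  have vnear : near v d.
    have /(nearZ (N y)^-1) : near y (d / (m j.+1)%:R).
      by apply: near_average => // i; have [_ [_ _ h _] _ _] := hrx (phi i).
    apply: near_le; rewrite gtr0_norm ?invr_gt0// mulrC -mulrA -[leRHS]mulr1.
    by rewrite ler_wpM2l ?(ltW d0)// -invfM invf_le1 ?mulr_gt0// -ler_pdivrMl// mulr1.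
  have vsupp : supp_ge v N1.
    move=> n vn; rewrite leqNgt; apply/negP => nN1; move/eqP: vn; apply.
    rewrite c00Z block_comb_eq0 ?mulr0// => i _; apply/eqP/negPn/negP => xn.
    have [_ [xsupp _ _ _] _ _] := hrx (phi i).
    by have := xsupp _ xn; have := rN1 (phi i); lia.
  exists v; split=> //.
  have [yhalf|yhalf] := leP (N y) 2^-1.
    exists (flatten [seq (F \o phi) (val i) | i <- enum 'I_q]).
    by apply: ell1_witness_average => // [i|]; rewrite ?y0//; exact: hF.
  exfalso; apply: noflat; exists v; split=> //.
  - by move=> n /vsupp; exact: leq_trans.
  - exact: near_le vnear.
  - move=> i t E ij ME; rewrite /v.
    under eq_bigr do rewrite restrZ (tsiZ hN) gtr0_norm ?invr_gt0//.
    rewrite -mulr_sumr.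
    have := sum_adm_block_average hxr' x1 ap a1 hP ij ME.
    rewrite -/y => h; rewrite ler_pdivrMl//; apply: le_trans h _; lra.
have [v [_ v1 _ [L [L0 _ Lb LF Lsum]]]] := claim (l j.+1) N0 eps (leqnn _) (introT andP (conj eps0 (lexx _))).
have ML := iter_prod_sub_mixed hc LF.
have filt : [seq G <- L | G != fset0] = L.
  by apply/all_filterP/allP => G GL; apply: contraNneq L0 => <-.
have := tsi_seq hN th0 v (k := j.+1) (L := L); rewrite filt => /(_ ML Lb).
rewrite v1 /theta ler_pdivrMl; last by rewrite ltr0n; exact/ltnW/(weight_gt1 hc).
rewrite mulr1 => /(le_trans Lsum); rewrite -natrX ler_nat.
have := power_gt hc j; lia.
Qed.

End James.

(** * Averages of rapidly increasing sequences *)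

Section RIS.
Variables (R : realType) (m k s l : nat -> nat).
Hypothesis hc : admissible_choice R m k s l.

Let theta j : R := (m j)%:R^-1.
Let N : c00 R -> R := tsirelson_norm (mixed_family s l) theta.
Let hN : is_tsirelson_norm (mixed_family s l) theta N := mixed_normP hc.
Let th0 : forall j, 0 < theta j := theta_gt0 hc.
Let thh : forall j, theta j <= 2^-1 := theta_half hc.

Section Estimate.
Variables (j : nat) (x : nat -> c00 R) (r : nat -> nat) (a : nat -> R) (q : nat).
Hypothesis hxr : block_sequence x r.
Hypothesis x1 : forall i, N (x i) = 1.
Hypothesis a0 : forall i, 0 <= a i.
Hypothesis xflat : forall i, flat m s l (r i) (x i).
Hypothesis rj : forall i, (j < r i)%N.
Hypothesis xcard : forall i, (m j.+1 * #|` c00_supp (x i)| <= m (r i.+1))%N.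

Let mu (A : {set 'I_q}) := half_norm (k j) (unit_comb r a A).
Let mass (A : {set 'I_q}) := \sum_(i in A) a i.
Let bound (A : {set 'I_q}) := 4 * mu A + 4 * theta j.+1 * mass A.

Let mu_ge0 A : 0 <= mu A.
Proof. exact: tsi_ge0 (half_normP R (k j)) _. Qed.

Let mass_ge0 A : 0 <= mass A.
Proof. exact: sumr_ge0. Qed.

Let restrI_le (E F : {fset nat}) u : N (restr (E `&` F)%fset u) <= N (restr E u).
Proof. by rewrite fsetIC -restr_restr; exact: (tsi_restr hN th0 thh). Qed.

Let coef_le_mu (A : {set 'I_q}) i : i \in A -> a (val i) <= mu A.
Proof.
have kk := prednK (schreier_index_gt0 hc j).
have hPn := half_normP R (k j); rewrite -[X in schreier_iter X]kk in hPn.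
exact: (coef_le_unit_comb hPn hxr a0).
Qed.

(** Flatness allows splitting with c = 4, the same constant as the coefficient of [mu] in [bound].
    The pieces and the spilling blocks then combine into 4 * (sum of mu (L i') + e) <= 8 * mu A. The
    weight at most 1/2 in [ris_bound] turns 8 back into 4 and closes the induction. The
    intersections with [F] may be empty, which the splitting allows. *)
Lemma ris_low_adm (A : {set 'I_q}) i t (E : 'I_t -> {fset nat}) F :
  (forall (B : {set 'I_q}) G, B \proper A -> N (restr G (block_comb x a B)) <= bound B) ->
  (i <= j)%N -> admissible (mixed_family s l i) E ->
  \sum_(i' < t) N (restr (E i' `&` F)%fset (block_comb x a A)) <=
    8 * mu A + 4 * theta j.+1 * mass A.
Proof.
move=> IH ij ME; have [A0|Aneq0] := eqVneq A finset.set0.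
  rewrite big1 ?addr_ge0 ?mulr_ge0// ?(ltW (th0 _))// => i' _.
  by rewrite A0 /block_comb big_set0 restr0 (tsi0 hN).
have [kap [Mkap hE]] := ME; have [_ kle _] := hE.
have kF := mixed_family_sub hc ij Mkap.
have kk := prednK (schreier_index_gt0 hc j); rewrite -kk in kF.
have hPn := half_normP R (k j); rewrite -[X in schreier_iter X]kk in hPn.
have [|||L [e [Lprop le1 le2 le3]]] := @split_block_comb _ _ _ hPn _ _ a q hxr a0 _ _ _ _ hN
  _ kap (fun i' => E i' `&` F)%fset kF (interlaced_mono hE) _ _ A 4 Aneq0.
- by move=> i' n; rewrite inE => /andP[/kle].
- move=> i1 i2 i12; apply: before_sub (interlaced_before hE i12);
    by move=> n; rewrite inE => /andP[].
- move=> k0 _; apply: le_trans (xflat (leq_ltn_trans ij (rj k0)) ME).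
  by apply: ler_sum => i' _; exact: restrI_le.
apply: le_trans le1 _.
have h1 : \sum_(i' < t) N (restr (E i' `&` F)%fset (block_comb x a (L i'))) <=
    4 * \sum_(i' < t) mu (L i') + 4 * theta j.+1 * \sum_(i' < t) mass (L i').
  by rewrite !mulr_sumr -big_split/=; apply: ler_sum => i' _; exact: IH.
have {}le2 : \sum_(i' < t) mu (L i') + e <= 2 * mu A := le2.
have {le3}h3 : 4 * theta j.+1 * \sum_(i' < t) mass (L i') <= 4 * theta j.+1 * mass A.
  by apply: ler_wpM2l le3; rewrite mulr_ge0// ltW.
move: (mu A) (\sum_(i' < t) mu _) h1 le2 h3 => M S.
move: (4 * theta j.+1 * _) (4 * theta j.+1 * _) (\sum_(i' < t) N _) => T1 T2 T3.
lra.
Qed.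

(** Three ranges of [i]. Below [r k0] the block is flat for the family. From [r k0.+1] on, the
    weight beats the size of the support, by [xcard] and [tsi_card]. In between only the trivial
    bound 1 is available, but these intervals are disjoint, so [i] falls into that of at most one
    block. *)
Let high_weight i t (E : 'I_t -> {fset nat}) (k0 : nat) : (j < i)%N ->
  admissible (mixed_family s l i) E ->
  theta i * \sum_(i' < t) N (restr (E i') (x k0)) <=
    4 * theta j.+1 + (r k0 <= i < r k0.+1)%N%:R.
Proof.
move=> ji ME; have thij : theta i <= theta j.+1.
  rewrite lef_pV2 ?posrE ?ltr0n ?ler_nat; first exact: (weight_le hc).
    exact/ltnW/(weight_gt1 hc).
  exact/ltnW/(weight_gt1 hc).
have [irk|rki] := ltnP i (r k0).
  rewrite addr0 mulrC ler_pM// ?(ltW (th0 _))//; last exact: xflat ME.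
  by apply: sumr_ge0 => i' _; exact: tsi_ge0 hN _.
have [irk|rki'] := ltnP i (r k0.+1).
  apply: ler_wpDl; first by rewrite mulr_ge0// ltW.
  by have := tsi_adm hN th0 (x k0) ME; rewrite x1.
rewrite addr0; have [kap [_ hE]] := ME.
have := tsi_card hN th0 thh (x k0) (interlaced_before hE); rewrite x1 mulr1 => h.
apply: le_trans (ler_wpM2l (ltW (th0 i)) h) _.
apply: (@le_trans _ _ (theta j.+1)); last first.
  by rewrite ler_peMl ?ler1n// ltW.
rewrite /theta mulrC ler_pdivrMr ?ltr0n; last exact/ltnW/(weight_gt1 hc).
rewrite mulrC ler_pdivlMr ?ltr0n; last exact/ltnW/(weight_gt1 hc).
rewrite -natrM ler_nat mulnC; apply: leq_trans (xcard k0) _.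
exact: (weight_le hc).
Qed.

(** Induction on the number of blocks, for all restrictions at once, since the implicit equation
    produces restrictions of the combination. For families of index above [j], the one block without
    a small estimate is absorbed by [mu A], which dominates each coefficient. *)
Lemma ris_bound (A : {set 'I_q}) F : N (restr F (block_comb x a A)) <= bound A.
Proof.
have [n] := ubnP #|A|; elim: n A F => // n IH A F; rewrite ltnS => An.
have {}IH (B : {set 'I_q}) G : B \proper A -> N (restr G (block_comb x a B)) <= bound B.
  by move=> /proper_card BA; apply: IH; exact: leq_trans An.
have b0 : mu A <= bound A.
  rewrite /bound; apply: ler_wpDr; first by rewrite !mulr_ge0// ltW.
  by rewrite ler_peMl// ler1n.
apply: (tsi_le hN th0) => [i|i t E ME].
  rewrite restrE; case: ifP => _; last by rewrite normr0; exact: le_trans b0.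
  have [/existsP[k0 /andP[kA xi]]|/existsPn h] :=
      boolP [exists k0 : 'I_q, (k0 \in A) && (x k0 i != 0)].
    rewrite (block_comb_coord a hxr kA xi) normrM ger0_norm//.
    apply: le_trans b0; apply: le_trans (coef_le_mu kA).
    by rewrite ler_piMr//; have := tsi_coord hN (x k0) i; rewrite x1.
  rewrite block_comb_eq0 ?normr0; first exact: le_trans b0.
  by move=> k0 kA; apply/eqP; have := h k0; rewrite kA negbK.
under eq_bigr do rewrite restr_restr.
have [ij|ji] := leqP i j.
  apply: le_trans (ler_wpM2l (ltW (th0 i)) (ris_low_adm F IH ij ME)) _.
  have u0 : 0 <= 8 * mu A + 4 * theta j.+1 * mass A.
    by rewrite addr_ge0 ?mulr_ge0// ltW.
  apply: le_trans (ler_wpM2r u0 (thh i)) _; rewrite /bound.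
  have : 0 <= 4 * theta j.+1 * mass A by rewrite !mulr_ge0// ltW.
  move: (4 * _ * _) (mu A) => u v; lra.
apply: (@le_trans _ _ (\sum_(k0 in A) a k0 * (theta i *
    \sum_(i' < t) N (restr (E i') (x k0))))).
  under [leRHS]eq_bigr do rewrite mulrCA mulr_sumr.
  rewrite -mulr_sumr exchange_big/= ler_wpM2l ?(ltW (th0 i))//.
  apply: ler_sum => i' _; rewrite restr_sum; apply: le_trans (tsi_sum hN _ _ _) _.
  apply: ler_sum => k0 _; rewrite restrZ (tsiZ hN) ger0_norm// ler_wpM2l//.
apply: (@le_trans _ _ (\sum_(k0 in A) a k0 *
    (4 * theta j.+1 + (r k0 <= i < r k0.+1)%N%:R))).
  by apply: ler_sum => k0 _; rewrite ler_wpM2l//; exact: high_weight.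
under eq_bigr do rewrite mulrDr.
rewrite big_split/= -mulr_suml /bound [leRHS]addrC; apply: lerD; first by rewrite mulrC.
apply: (@le_trans _ _ (mu A)); last by rewrite ler_peMl// ler1n.
have [/existsP[k0 /andP[kA rk]]|/existsPn h] :=
    boolP [exists k0 : 'I_q, (k0 \in A) && (r k0 <= i < r k0.+1)%N].
  rewrite (bigD1 k0)//= rk mulr1 big1 ?addr0; first exact: coef_le_mu.
  move=> k1 /andP[_ k1k0]; case: (boolP (_ && _)); last by rewrite mulr0.
  move=> /andP[rk1 rk1']; case/andP: rk => rk rk'.
  case: (ltngtP (val k1) (val k0)) => [h|h|/val_inj kk].
  - have : (r k1.+1 <= r k0)%N by rewrite (leq_mono (block_index_homo hxr)).
    lia.
  - have : (r k0.+1 <= r k1)%N by rewrite (leq_mono (block_index_homo hxr)).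
    lia.
  - by rewrite kk eqxx in k1k0.
rewrite big1// => k0 kA; have := h k0; rewrite kA/= => /negbTE ->; by rewrite mulr0.
Qed.

End Estimate.

Variable near : c00 R -> R -> Prop.
Hypothesis near0 : near 0 0.
Hypothesis nearD : forall u v d e, near u d -> near v e -> near (u + v) (d + e).
Hypothesis nearZ : forall a u e, near u e -> near (a *: u) (`|a| * e).
Hypothesis near_le : forall u d e, d <= e -> near u d -> near u e.
Hypothesis near_block : forall n e, 0 < e ->
  exists u, [/\ supp_ge u n, N u = 1 & near u e].

(** The last clause carries no factor [theta i] on its left side: sums over families of smaller
    index are bounded by the same quantity as the norm itself. This contrasts with the preceding
    clause, where the family of index [j.+1] gains a factor of order m_{j+1}. *)
Lemma ris_average j eps : 0 < eps -> exists y,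
  [/\ near y eps, theta j.+1 <= N y <= 5 * theta j.+1,
      exists t (E : 'I_t -> {fset nat}), admissible (mixed_family s l j.+1) E /\
        \sum_(i < t) N (restr (E i) y) = 1 &
      forall i t (E : 'I_t -> {fset nat}), (i <= j)%N ->
        admissible (mixed_family s l i) E ->
        \sum_(i' < t) N (restr (E i') y) <= 5 * theta j.+1].
Proof.
move=> eps0.
pose Q n v := [/\ supp_ge v n, N v = 1, near v eps & flat m s l n v].
have [n jn|r [x [r0 hrx]]] := @dependent_sequence _ Q
    (fun v => maxn (2 * c00_bound v) (m j.+1 * #|` c00_supp v|))%N j.+1.
  (* [flat_block] at index [n.-1] gives flatness for all families of index below [n], the starting
     point of the block. *)
  have n0 : (0 < n)%N by exact: leq_trans jn.
  have [v] := flat_block hc near0 nearD nearZ near_le near_block n.-1 n eps0.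
  by rewrite prednK//; exists v.
have hxr : block_sequence x r.
  move=> i; have [_ [xsupp _ _ _] h rr] := hrx i; split=> // n xn; split; first exact: xsupp.
  apply: leq_trans h; apply: leq_trans (leq_maxl _ _).
  by rewrite leq_mul2l c00_boundP.
have [_ _ _ _ _ /(_ j) small _] := hc.
have [|q [phi [a [hphi a0 a1 sF hP]]]] := block_average small hxr.
  by rewrite r0.
have hxr' := block_sequence_sub hphi hxr.
have x1 i : N ((x \o phi) i) = 1 by have [_ [_ h _ _] _ _] := hrx (phi i).
have xflat i : flat m s l ((r \o phi) i) ((x \o phi) i).
  by have [_ [_ _ _ h] _ _] := hrx (phi i).
have ap i : 0 <= a i := (a0 i).1.
have rj i : (j < (r \o phi) i)%N by have [h _ _ _] := hrx (phi i).
have xcard i : (m j.+1 * #|` c00_supp ((x \o phi) i)| <= m ((r \o phi) i.+1))%N.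
  have [_ _ h _] := hrx (phi i); apply: leq_trans (leq_trans (leq_maxr _ _) h) _.
  apply: (@leq_trans (r (phi i.+1))).
    by rewrite (leq_mono (block_index_homo hxr)) hphi.
  by apply: leq_trans (weight_ge hc _); exact: leq_addr.
set y := block_comb (x \o phi) a [set: 'I_q].
have mass1 : \sum_(i in [set: 'I_q]) a i = 1.
  by rewrite -a1; apply: eq_bigl => i; rewrite inE.
(* 8 times the bound 3 / m_{j+2}^4 of [block_average]; what is needed is 24 * m_{j+1} <= m_{j+2}^4.
   With 4 * theta from the mass this gives the constant 5. *)
have small_mu : 8 * half_norm (k j) (unit_comb (r \o phi) a [set: 'I_q]) <= theta j.+1.
  have h8 : (0 : R) <= 8 by rewrite ler0n.
  apply: le_trans (ler_wpM2l h8 hP) _; rewrite mulrA -natrM.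
  have m_gt0 i : (0 : R) < (m i)%:R by rewrite ltr0n; exact/ltnW/(weight_gt1 hc).
  rewrite ler_pdivrMr ?exprn_gt0// mulrC ler_pdivlMr// -natrM -natrX ler_nat.
  have M4 : (4 <= m j.+2)%N by apply: leq_trans (weight_ge hc j.+2); rewrite addnC.
  have jM : (m j.+1 <= m j.+2)%N by apply: (weight_le hc).
  rewrite mulnC; apply: (@leq_trans (m j.+2 * 4 ^ 3)); first by apply: leq_mul.
  by rewrite [leqRHS]expnS leq_mul2l leq_exp2r// M4 orbT.
have mu0 : 0 <= half_norm (k j) (unit_comb (r \o phi) a [set: 'I_q]).
  exact: tsi_ge0 (half_normP R (k j)) _.
have bound_le := ris_bound hxr' x1 ap xflat rj xcard.
exists y; split.
- apply: (near_average near0 nearD nearZ) => // i.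
  by have [_ [_ _ h _] _ _] := hrx (phi i).
- apply/andP; split; first exact: (norm_block_average_ge hc hxr' x1 ap a1 sF).
  have := bound_le q [set: 'I_q] (c00_supp y); rewrite restr_id; last first.
    by move=> n; rewrite mem_c00_supp.
  rewrite mass1 mulr1 => /le_trans; apply.
  move: (half_norm _ _) (theta j.+1) small_mu mu0 => u v; lra.
- exists q, (fun i : 'I_q => c00_supp ((x \o phi) (val i))); split.
    have [k0 [Mk hk]] := supp_admissible hc hxr' x1 sF; exists k0; split=> //.
    exact: schreier_sub_mixed Mk.
  exact: (sum_supp_block_average hc hxr' x1 ap a1).
- move=> i t E ij ME.
  have := @ris_low_adm j _ _ a q hxr' ap xflat rj [set: 'I_q] i t E (c00_supp y)
    (fun B G _ => bound_le q B G) ij ME.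
  have -> : \sum_(i' < t) N (restr (E i' `&` c00_supp y)%fset
      (block_comb (x \o phi) a [set: 'I_q])) = \sum_(i' < t) N (restr (E i') y).
    apply: eq_bigr => i' _; rewrite -restr_restr [restr (c00_supp _) _]restr_id//.
    by move=> n; rewrite mem_c00_supp.
  rewrite mass1 mulr1 => /le_trans; apply.
  move: (half_norm _ _) (theta j.+1) small_mu mu0 => u v; lra.
Qed.

End RIS.

(** * Extension from finitely supported vectors to the completion *)

(** If [f] does not vanish at some z0 in [Z], then z0 together with a finite family spanning the
    kernel spans [Z]. *)
Lemma infinite_dimensional_kernel (R : realType) (Y : lmodType R) (Z : set Y) (f : Y -> R) :
  (forall a x y, Z x -> Z y -> Z (a *: x + y)) ->
  (forall a x y, f (a *: x + y) = a * f x + f y) ->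
  infinite_dimensional Z -> infinite_dimensional [set z | Z z /\ f z = 0]%classic.
Proof.
move=> Zlin flin Zinf [n [v [vK span]]]; apply: Zinf.
have [[z0 Zz0 fz0]|nz] := pselect (exists2 z0, Z z0 & f z0 != 0); last first.
  exists n, v; split=> [i|z Zz]; first by have [] := vK i.
  apply: span; split=> //; apply/eqP/negPn/negP => fz.
  by apply: nz; exists z.
pose cons (T : Type) (t : T) (w : 'I_n -> T) (i : 'I_n.+1) : T := oapp w t (unlift ord0 i).
have cons0 T t w : cons T t w ord0 = t by rewrite /cons unlift_none.
have consS T t w i : cons T t w (lift ord0 i) = w i by rewrite /cons liftK.
exists n.+1, (cons Y z0 v); split=> [i|z Zz].
  case: (unliftP ord0 i) => [j|] ->; last by rewrite cons0.
  by rewrite consS; have [] := vK j.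
have [|a za] := span (- (f z / f z0) *: z0 + z).
  split; first exact: Zlin.
  by rewrite flin mulNr divfK// addNr.
exists (cons R (f z / f z0) a); rewrite big_ord_recl !cons0.
under eq_bigr do rewrite !consS.
by rewrite -za scaleNr addNKr.
Qed.

Section Extension.
Variables (R : realType) (X : completeNormedModType R) (iota : {linear c00 R -> X}).
Hypothesis iota_dense : dense (range iota).

Lemma dense_approx (x : X) e : 0 < e -> exists u, `|x - iota u| < e.
Proof.
move=> e0; have [|y [xz [u _ uy]]] := iota_dense _ (ball_open x e).
  by exists x; exact: ballxx.
by exists u; move: xz; rewrite -uy -ball_normE.
Qed.

Section InfConvolution.
Variables (f : c00 R -> R) (C : R).
Hypothesis C0 : 0 <= C.
Hypothesis f_lip : forall u v, f u <= f v + C * `|iota (u - v)|.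

(* The largest C-Lipschitz extension of f (McShane). *)
Definition inf_convolution (x : X) : R :=
  inf [set f u + C * `|x - iota u| | u in [set: c00 R]]%classic.

Lemma inf_convolution_ge x B : (forall u, B <= f u + C * `|x - iota u|) ->
  B <= inf_convolution x.
Proof.
move=> hB; apply: lb_le_inf; first by exists (f 0 + C * `|x - iota 0|), 0.
by move=> _ [u _ <-].
Qed.

Lemma inf_convolution_le x u : inf_convolution x <= f u + C * `|x - iota u|.
Proof.
apply: ge_inf; last by exists u.
exists (f 0 - C * `|x|) => _ [v _ <-]; rewrite lerBlDr.
apply: le_trans (f_lip 0 v) _; rewrite -addrA lerD2l -mulrDr ler_wpM2l// sub0r linearN normrN.
by have := ler_normD (iota v - x) x; rewrite subrK distrC.
Qed.

Lemma inf_convolution_ge_sub x u : f u - C * `|x - iota u| <= inf_convolution x.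
Proof.
apply: inf_convolution_ge => v; rewrite lerBlDr; apply: le_trans (f_lip u v) _.
rewrite -addrA lerD2l -mulrDr ler_wpM2l// linearB.
by rewrite [leRHS]addrC [X in _ <= X + _]distrC; exact: ler_distD.
Qed.

Lemma inf_convolutionE u : inf_convolution (iota u) = f u.
Proof.
apply/eqP; rewrite eq_le; have := inf_convolution_le (iota u) u.
have := inf_convolution_ge_sub (iota u) u.
by rewrite subrr normr0 mulr0 subr0 addr0 => -> ->.
Qed.

End InfConvolution.

Variable N : c00 R -> R.
Hypothesis iotaN : forall u, `|iota u| = N u.
Hypothesis N_coord : forall (u : c00 R) n, `|u n| <= N u.

(** The coordinate is 1-Lipschitz on [c00], so it has a McShane extension. Such an extension need
    not be linear in general; here the approximation property and density force linearity. *)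
Lemma coordinate_extension n : exists F : X -> R,
  (forall x (u : c00 R), `|F x - u n| <= `|x - iota u|) /\
  forall a x y, F (a *: x + y) = a * F x + F y.
Proof.
have lip (u v : c00 R) : u n <= v n + 1 * `|iota (u - v)|.
  by rewrite mul1r -lerBlDl iotaN; apply: le_trans (N_coord _ n); exact: ler_norm.
pose F := inf_convolution (fun u : c00 R => u n) 1.
have Fapprox x (u : c00 R) : `|F x - u n| <= `|x - iota u|.
  have := inf_convolution_le ler01 lip x u.
  have := inf_convolution_ge_sub ler01 lip x u; rewrite /F !mul1r ler_distl => -> ->//.
exists F; split=> // a x y; apply/eqP; rewrite -subr_eq0 -normr_le0.
apply/ler_addgt0Pl => e e0; rewrite addr0.
pose d := e / (2 * (`|a| + 1)).
have a1 : 0 < `|a| + 1 by rewrite ltr_wpDl.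
have d0 : 0 < d by rewrite divr_gt0// mulr_gt0.
have [u /ltW xu] := dense_approx x d0; have [v /ltW yv] := dense_approx y d0.
have -> : F (a *: x + y) - (a * F x + F y) =
    (F (a *: x + y) - (a *: u + v) n) - (a * (F x - u n) + (F y - v n)).
  have -> : (a *: u + v) n = a * u n + v n by [].
  rewrite mulrBr; move: (F _) (F x) (F y) (u n) (v n) => p1 p2 p3 p4 p5.
  move: (a * p2) (a * p4) => p6 p7; lra.
have -> : e = (`|a| * d + d) + (`|a| * d + d).
  have <- : 2 * (`|a| + 1) * d = e by rewrite mulrC divfK// gt_eqF// mulr_gt0.
  by rewrite -mulrA mulr_natl mulr2n mulrDl mul1r.
apply: le_trans (ler_normB _ _) _; apply: lerD.
  apply: le_trans (Fapprox _ _) _.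
  rewrite linearP opprD addrACA -scalerBr; apply: le_trans (ler_normD _ _) _.
  by rewrite lerD// normrZ ler_wpM2l.
apply: le_trans (ler_normD _ _) _; rewrite normrM.
by apply: lerD; [rewrite ler_wpM2l//|]; apply: le_trans (Fapprox _ _) _.
Qed.

End Extension.

(** * Normalized vectors with far support close to a subspace *)

Section Space.
Variables (R : realType) (m k s l : nat -> nat).
Hypothesis hc : admissible_choice R m k s l.
Variables (X : completeNormedModType R) (iota : {linear c00 R -> X}).

Let theta j : R := (m j)%:R^-1.
Let N : c00 R -> R := tsirelson_norm (mixed_family s l) theta.
Let hN : is_tsirelson_norm (mixed_family s l) theta N := mixed_normP hc.
Let th0 : forall j, 0 < theta j := theta_gt0 hc.
Let thh : forall j, theta j <= 2^-1 := theta_half hc.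

Hypothesis iotaN : forall u, `|iota u| = N u.
Hypothesis iota_dense : dense (range iota).

Section Subspace.
Variable Z : set X.
Hypothesis Z_submod : submod_closed [in Z].
Hypothesis Z_inf : infinite_dimensional Z.

Lemma subspace0 : Z 0.
Proof. by have [+ _] := Z_submod; rewrite inE. Qed.

Lemma subspace_lin a x y : Z x -> Z y -> Z (a *: x + y).
Proof. by have [_ /(_ a x y)] := Z_submod; rewrite !inE. Qed.

Lemma subspaceZ a x : Z x -> Z (a *: x).
Proof. by move=> Zx; rewrite -[_ *: _]addr0; apply: subspace_lin => //; exact: subspace0. Qed.

Definition near_subspace (u : c00 R) (e : R) := exists2 z, Z z & `|iota u - z| <= e.

Lemma near_subspace0 : near_subspace 0 0.
Proof. by exists 0; [exact: subspace0|rewrite linear0 subrr normr0]. Qed.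

Lemma near_subspaceD u v d e : near_subspace u d -> near_subspace v e ->
  near_subspace (u + v) (d + e).
Proof.
move=> [x Zx ux] [y Zy vy]; exists (x + y).
  by rewrite -[x]scale1r; exact: subspace_lin.
by rewrite linearD opprD addrACA; apply: le_trans (ler_normD _ _) (lerD ux vy).
Qed.

Lemma near_subspaceZ a u e : near_subspace u e -> near_subspace (a *: u) (`|a| * e).
Proof.
move=> [x Zx ux]; exists (a *: x); first exact: subspaceZ.
by rewrite linearZ -scalerBr normrZ ler_wpM2l.
Qed.

Lemma near_subspace_le u d e : d <= e -> near_subspace u d -> near_subspace u e.
Proof. by move=> de [x Zx ux]; exists x => //; exact: le_trans ux de. Qed.

Lemma subspace_null_coordinates (F : nat -> X -> R) n :
  (forall i a x y, F i (a *: x + y) = a * F i x + F i y) ->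
  exists z, [/\ Z z, z != 0 & forall i, (i < n)%N -> F i z = 0].
Proof.
move=> Flin.
pose Zn n : set X := [set z | Z z /\ forall i, (i < n)%N -> F i z = 0]%classic.
have Fi0 i : F i 0 = 0.
  by have := Flin i (-1) 0 0; rewrite scaler0 addr0 mulN1r addNr.
have Zn_inf : infinite_dimensional (Zn n).
  elim: n => [|p IH].
    move=> [q [v [vZ span]]]; apply: Z_inf; exists q, v; split=> [i|z Zz].
      by have [] := vZ i.
    exact: span.
  have Zlin a x y : Zn p x -> Zn p y -> Zn p (a *: x + y).
    move=> [Zx xF] [Zy yF]; split; first exact: subspace_lin.
    by move=> i ip; rewrite Flin xF// yF// mulr0 addr0.
  have := infinite_dimensional_kernel Zlin (Flin p) IH; congr (infinite_dimensional _).
  apply/seteqP; split=> z /=.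
    move=> [[Zz zF] zp]; split=> // i; rewrite ltnS leq_eqVlt => /orP[/eqP ->//|].
    exact: zF.
  move=> [Zz zF]; split; last exact: zF.
  by split=> // i ip; apply: zF; exact: leqW.
apply: contrapT => nex; apply: Zn_inf; exists 0%N, (fun i => 0); split=> [[]//|z [Zz zF]].
exists (fun i => 0); rewrite big_ord0; apply/eqP/negPn/negP => z0.
by apply: nex; exists z.
Qed.

(** A unit vector of [Z] with null coordinates below [n] is approximated in [c00]; the first
    coordinates of the approximation are then small and can be removed. *)
Lemma near_subspace_block n e : 0 < e ->
  exists u, [/\ supp_ge u n, N u = 1 & near_subspace u e].
Proof.
move=> e0.
have /choice[F hF] i := coordinate_extension iota_dense iotaN (tsi_coord hN) i.
have [z0 [Zz0 z00 zF0]] := subspace_null_coordinates n (fun i => (hF i).2).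
pose z := `|z0|^-1 *: z0.
have z1 : `|z| = 1 by rewrite normrZ normfV normr_id mulVf// normr_eq0.
have Zz : Z z by exact: subspaceZ.
have zF i : (i < n)%N -> F i z = 0.
  move=> /zF0 h; have Fi0 : F i 0 = 0.
    by have := (hF i).2 (-1) 0 0; rewrite scaler0 addr0 mulN1r addNr.
  by rewrite /z -[_ *: _]addr0 (hF i).2 h Fi0 mulr0 addr0.
(* The bound 1/2 keeps the norm of [v] at least 1/2, so that normalizing at most doubles the error;
   e / 2 compensates for that. *)
pose eta := Num.min 2^-1 (e / 2).
have eta0 : 0 < eta by rewrite lt_min invr_gt0 divr_gt0// andbT.
have eta1 : eta <= 2^-1 by rewrite ge_min lexx.
have eta2 : eta <= e / 2 by rewrite ge_min lexx orbT.
pose d := eta / n.+1%:R.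
have d0 : 0 < d by rewrite divr_gt0.
have [u /ltW zu] := dense_approx iota_dense z d0.
(* Each of the [n] removed coordinates is at most [d], as [z] vanishes there. Together with the
   approximation error this gives (n + 1) * d = eta. *)
pose v := u - \sum_(i < n) u i *: c00_unit R i.
have vn : supp_ge v n.
  move=> i; rewrite leqNgt; apply: contra_neqN => inn.
  rewrite /v c00B c00_sum; have [->|i0] := posnP i.
    by rewrite c00P big1 ?subrr// => i' _; rewrite c00Z c00P mulr0.
  rewrite (bigD1 (Ordinal inn))// big1 => [|i' /andP[_ i'i]].
    by rewrite c00Z c00_unitE// eqxx mulr1 /= addr0 subrr.
  rewrite c00Z /= /c00_unit_fun; case: eqP => [ii|]; last by rewrite andbF mulr0.
  by case/eqP: i'i; apply/val_inj.
have zv : `|iota v - z| <= eta.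
  have -> : eta = d + n%:R * d.
    by rewrite -{1}[d]mul1r -mulrDl addrC natr1 /d mulrC divfK// pnatr_eq0.
  rewrite /v linearB -addrA [- _ - z]addrC addrA; apply: le_trans (ler_normB _ _) _.
  apply: lerD; first by rewrite distrC.
  rewrite iotaN; apply: le_trans (tsi_sum hN _ _ _) _.
  rewrite -[n in n%:R]card_ord -sumr_const mulr_suml; apply: ler_sum => i _.
  rewrite (tsiZ hN) mul1r -[leRHS]mulr1 ler_pM//; first exact: tsi_ge0 hN _.
    by have := (hF i).1 z u; rewrite zF// sub0r normrN => /le_trans; apply.
  exact: (tsi_unit hN th0 thh).
have Nv : 2^-1 <= N v.
  have := ler_normB (iota v) (iota v - z); rewrite subKr z1 iotaN => h.
  move: zv h; move: (`|_ - z|) (N v) eta1 => b c; lra.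
have Nv0 : 0 < N v by apply: lt_le_trans Nv; rewrite invr_gt0.
exists ((N v)^-1 *: v); split.
- move=> i; rewrite c00Z mulf_eq0 negb_or => /andP[_]; exact: vn.
- by rewrite (tsiZ hN) gtr0_norm ?invr_gt0// mulVf// gt_eqF.
- have /(near_subspaceZ (N v)^-1) : near_subspace v eta by exists z.
  apply: near_subspace_le; rewrite gtr0_norm ?invr_gt0// mulrC ler_pdivrMr//.
  by apply: le_trans eta2 _; rewrite ler_wpM2l// ltW.
Qed.

End Subspace.

(** * The distorting norms *)

Section DistortingNorm.
Variable j : nat.

Definition distort0 (u : c00 R) : R :=
  sup [set y | exists t (E : 'I_t -> {fset nat}),
    admissible (mixed_family s l j) E /\ y = \sum_(i < t) N (restr (E i) u)]%classic.

Let m_gt0 : (0 : R) < (m j)%:R.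
Proof. by rewrite ltr0n; exact/ltnW/(weight_gt1 hc). Qed.

Lemma distort0_adm u t (E : 'I_t -> {fset nat}) :
  admissible (mixed_family s l j) E -> \sum_(i < t) N (restr (E i) u) <= distort0 u.
Proof.
move=> ME; apply: ub_le_sup; last by exists t, E.
by exists ((m j)%:R * N u) => _ [t' [E' [ME' ->]]]; exact: (norm_adm_le hc).
Qed.

Lemma admissible_single (F : {fset nat}) : F != fset0 -> (0 < fmin F)%N ->
  admissible (mixed_family s l j) (fun _ : 'I_1 => F).
Proof.
move=> F0 Fmin0; exists (fun=> fmin F); split; last first.
  split=> // [_ n|i i']; first by have [_] := fminP F0; exact.
  by have := ltn_ord i'; rewrite [i']ord1 [i]ord1.
rewrite (_ : [fset _ | i : 'I__]%fset = [fset fmin F]%fset).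
  exact: mixed_family_single.
apply/fsetP => n; rewrite inE; apply/imfsetP/eqP => [[i _ ->]//|->].
by exists ord0.
Qed.

Lemma distort0_le u B :
  (forall t (E : 'I_t -> {fset nat}), admissible (mixed_family s l j) E ->
    \sum_(i < t) N (restr (E i) u) <= B) -> distort0 u <= B.
Proof.
move=> h; apply: ge_sup => [|_ [t [E [ME ->]]]]; last exact: h.
have adm1 : admissible (mixed_family s l j) (fun _ : 'I_1 => [fset 1%N]%fset).
  by apply: admissible_single; rewrite ?fmin1//; apply/fset0Pn; exists 1%N; rewrite inE.
by eexists; exists 1%N, (fun=> [fset 1%N]%fset); split.
Qed.

(** The family consisting of the support of [u] alone is admissible. *)
Lemma norm_le_distort0 u : N u <= distort0 u.
Proof.
have [u0|/c00_neq0[n un]] := eqVneq u 0.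
  rewrite u0 (tsi0 hN).
  have adm1 : admissible (mixed_family s l j) (fun _ : 'I_1 => [fset 1%N]%fset).
    by apply: admissible_single; rewrite ?fmin1//; apply/fset0Pn; exists 1%N; rewrite inE.
  by apply: le_trans (distort0_adm 0 adm1); apply: sumr_ge0 => i _; exact: tsi_ge0 hN _.
have supp0 : c00_supp u != fset0 by apply/fset0Pn; exists n; rewrite mem_c00_supp.
have adm1 : admissible (mixed_family s l j) (fun _ : 'I_1 => c00_supp u).
  apply: admissible_single => //; have [+ _] := fminP supp0.
  by rewrite mem_c00_supp; case: (fmin _) => //; rewrite c00P eqxx.
apply: le_trans (distort0_adm u adm1); rewrite big_ord1 restr_id//.
by move=> i; rewrite mem_c00_supp.
Qed.

Lemma distort0_le_norm u : distort0 u <= (m j)%:R * N u.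
Proof. by apply: distort0_le => t E; exact: (norm_adm_le hc). Qed.

Lemma distort0D u v : distort0 (u + v) <= distort0 u + distort0 v.
Proof.
apply: distort0_le => t E ME.
apply: le_trans (lerD (distort0_adm u ME) (distort0_adm v ME)).
by rewrite -big_split/=; apply: ler_sum => i _; rewrite restrD; exact: tsiD hN _ _.
Qed.

Lemma distort0Z a u : distort0 (a *: u) <= `|a| * distort0 u.
Proof.
apply: distort0_le => t E ME.
apply: le_trans (ler_wpM2l (normr_ge0 a) (distort0_adm u ME)).
by rewrite mulr_sumr; apply: ler_sum => i _; rewrite restrZ (tsiZ hN).
Qed.

(** [distort0] is m_j-Lipschitz for the norm. Extending it by an infimum lets the properties of a
    norm pass to the completion without limits of sequences. *)
Definition distort : X -> R := inf_convolution iota distort0 (m j)%:R.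

Let lip u v : distort0 u <= distort0 v + (m j)%:R * `|iota (u - v)|.
Proof.
rewrite iotaN -{1}(subrK v u) addrC; apply: le_trans (distort0D _ _) _.
by rewrite lerD2l; exact: distort0_le_norm.
Qed.

Let m_ge0 : (0 : R) <= (m j)%:R := ler0n _ _.

Lemma distort_iota u : distort (iota u) = distort0 u.
Proof. exact: inf_convolutionE m_ge0 lip u. Qed.

Let distort_inf x u : distort x <= distort0 u + (m j)%:R * `|x - iota u|.
Proof. exact: inf_convolution_le m_ge0 lip x u. Qed.

Let distort_ge x B : (forall u, B <= distort0 u + (m j)%:R * `|x - iota u|) ->
  B <= distort x.
Proof. exact: inf_convolution_ge. Qed.

Lemma norm_le_distort x : `|x| <= distort x.
Proof.
apply: distort_ge => u; rewrite -{1}(subrK (iota u) x) addrC.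
apply: le_trans (ler_normD _ _) _; rewrite iotaN lerD ?norm_le_distort0//.
by rewrite ler_peMl// ler1n; exact/ltnW/(weight_gt1 hc).
Qed.

Lemma distort_le_norm x : distort x <= (m j)%:R * `|x|.
Proof.
apply: le_trans (distort_inf x 0) _; rewrite linear0 subr0.
suff : distort0 0 <= 0 by rewrite gerDr.
by apply: le_trans (distort0_le_norm 0) _; rewrite (tsi0 hN) mulr0.
Qed.

Lemma distortD x y : distort (x + y) <= distort x + distort y.
Proof.
rewrite -lerBlDr; apply: distort_ge => u; rewrite lerBlDr -lerBlDl.
apply: distort_ge => v; rewrite lerBlDl; apply: le_trans (distort_inf _ (u + v)) _.
rewrite addrACA -mulrDr lerD ?distort0D// ler_wpM2l// linearD opprD addrACA.
exact: ler_normD.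
Qed.

Let distortZ_le a x : a != 0 -> distort (a *: x) <= `|a| * distort x.
Proof.
move=> a0; rewrite -ler_pdivrMl ?normr_gt0//; apply: distort_ge => u.
rewrite ler_pdivrMl ?normr_gt0//; apply: le_trans (distort_inf _ (a *: u)) _.
by rewrite mulrDr lerD ?distort0Z// mulrCA linearZ -scalerBr normrZ.
Qed.

Lemma distortZ a x : distort (a *: x) = `|a| * distort x.
Proof.
have [->|a0] := eqVneq a 0.
  rewrite scale0r normr0 mul0r; apply/eqP; rewrite eq_le.
  have := norm_le_distort 0; have := distort_le_norm 0.
  by rewrite normr0 mulr0 => -> ->.
apply/eqP; rewrite eq_le distortZ_le//= -ler_pdivlMl ?normr_gt0// -normfV.
have := distortZ_le (a *: x) (invr_neq0 a0).
by rewrite scalerA mulVf// scale1r.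
Qed.

Lemma distort_equivalent : equivalent_norm distort.
Proof.
split; last first.
  exists 1, (m j)%:R; split=> // x.
  by rewrite mul1r norm_le_distort distort_le_norm.
split; [exact: distortD|exact: distortZ|move=> x x0].
by apply/eqP; rewrite -normr_le0 -x0; exact: norm_le_distort.
Qed.

Lemma distort_lip x y : distort x <= distort y + (m j)%:R * `|x - y|.
Proof.
rewrite -{1}(subrK y x) addrC; apply: le_trans (distortD _ _) _.
by rewrite lerD2l; exact: distort_le_norm.
Qed.

End DistortingNorm.
End Space.

(** * Comparison of the norms on a subspace *)

Theorem mainTheorem1 (R : realType) (m k s l : nat -> nat)
    (hc : admissible_choice R m k s l)
    (X : completeNormedModType R)
    (hX : is_tsirelson_space (mixed_family s l)
            (fun j : nat => ((m j)%:R : R)^-1) X) :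
  arbitrarily_distortable X.
Proof.
have [iota [iotaN iota_dense]] := hX; move=> lam lam1.
have lam_ge0 : 0 <= lam by apply: ltW; exact: lt_trans ltr01 lam1.
have lam0 : 0 <= 144 * lam by rewrite mulr_ge0.
(* 144 = 12 * 12: below, one unit vector has p-value at least m_{j+1} / 12 and another at most
   12. *)
pose j := Num.bound (144 * lam).
have mj : 144 * lam <= (m j.+1)%:R.
  apply: le_trans (ltW (archi_boundP lam0)) _; rewrite ler_nat -/j.
  apply: leq_trans (weight_ge hc _); lia.
exists (distort m s l iota j.+1); first exact: (distort_equivalent hc iotaN).
move=> Z Zsub _ Zinf.
pose th i : R := (m i)%:R^-1.
have th0 i : 0 < th i := theta_gt0 hc i.
have mth i : (m i)%:R * th i = 1.
  by rewrite mulfV// pnatr_eq0 -lt0n; exact/ltnW/(weight_gt1 hc).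
pose p := distort m s l iota j.+1.
have ris i e : 0 < e -> _ := ris_average hc (near_subspace0 iota Zsub)
  (near_subspaceD Zsub) (near_subspaceZ Zsub) (@near_subspace_le _ _ _ Z)
  (near_subspace_block hc iotaN iota_dense Zsub Zinf) i (eps := e).
have norml (a : R) (x : X) : 0 < a -> `|a *: x| = a * `|x|.
  by move=> a0; rewrite normrZ gtr0_norm.
have [x [Zx x1 px]] : exists x, [/\ Z x, `|x| = 1 & (m j.+1)%:R / 12 <= p x].
  (* As [p] is m_{j+1}-Lipschitz, this error lowers the p-value from 1 to 1/2 at worst, while the
     norm stays at most 6 * th j.+1. The quotient is m_{j+1} / 12. *)
  have e0 : 0 < th j.+1 / 2 by rewrite divr_gt0.
  have [y [[z Zz yz] /andP[yge yle] [t [E [ME Ey]]] _]] := ris j _ e0.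
  have py : 1 <= p (iota y).
    by rewrite /p (distort_iota hc iotaN) -Ey; exact: (distort0_adm hc).
  have pz : 2^-1 <= p z.
    have := distort_lip hc iotaN j.+1 (iota y) z; rewrite -/p.
    have : (m j.+1)%:R * `|iota y - z| <= 2^-1.
      apply: le_trans (ler_wpM2l (ler0n _ _) yz) _.
      by rewrite mulrA mth mul1r.
    move: py; move: (p z) (p _) (_ * _) => b c d; lra.
  have zle : `|z| <= 6 * th j.+1.
    have := ler_normB (iota y) (iota y - z); rewrite subKr iotaN.
    move: yz yle; rewrite -/th -/(th _).
    have := th0 j.+1; move: (`|z|) (th j.+1) (`|_ - z|) (tsirelson_norm _ _ y) => b c d f.
    lra.
  have z0 : 0 < `|z|.
    have := ler_normD (iota y - z) z; rewrite subrK iotaN.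
    move: yz yge; rewrite -/(th _).
    have := th0 j.+1; move: (`|z|) (th j.+1) (`|_ - z|) (tsirelson_norm _ _ y) => b c d f.
    lra.
  exists (`|z|^-1 *: z); split; first exact: subspaceZ.
    by rewrite norml ?invr_gt0// mulVf// gt_eqF.
  rewrite /p (distortZ hc iotaN) -/p gtr0_norm ?invr_gt0// ler_pdivlMl//.
  apply: le_trans pz; apply: le_trans (ler_wpM2r _ zle) _; first by rewrite divr_ge0.
  rewrite mulrA -[6 * _ * _]mulrA [th _ * _]mulrC mth mulr1; lra.
have [y [Zy y1 py]] : exists y, [/\ Z y, `|y| = 1 & p y <= 12].
  (* The factor [th j.+1] cancels the Lipschitz constant m_{j+1} of [p]. The p-value is then at most
     6 * th j.+2 and the norm at least th j.+2 / 2, with quotient 12. *)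
  have e0 : 0 < th j.+2 * th j.+1 / 2 by rewrite divr_gt0// mulr_gt0.
  have [y [[z Zz yz] /andP[yge _] _ padm]] := ris j.+1 _ e0.
  have py : p (iota y) <= 5 * th j.+2.
    by rewrite /p (distort_iota hc iotaN); apply: distort0_le => // t E; exact: padm.
  have th1 : th j.+1 <= 1.
    by rewrite /th invf_le1 ?ler1n ?ltr0n; exact/ltnW/(weight_gt1 hc).
  have yz' : `|iota y - z| <= th j.+2 / 2.
    apply: le_trans yz _; rewrite ler_wpM2r ?invr_ge0//.
    by rewrite ler_piMr// ltW.
  have zge : th j.+2 / 2 <= `|z|.
    have := ler_normD (iota y - z) z; rewrite subrK iotaN.
    move: yz' yge; rewrite -/(th _).
    move: (`|z|) (th j.+2) (`|_ - z|) (tsirelson_norm _ _ y) => b c d f.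
    lra.
  have z0 : 0 < `|z| by apply: lt_le_trans zge; rewrite divr_gt0.
  have pz : p z <= 6 * th j.+2.
    have := distort_lip hc iotaN j.+1 z (iota y); rewrite -/p distrC.
    have : (m j.+1)%:R * `|iota y - z| <= th j.+2.
      apply: le_trans (ler_wpM2l (ler0n _ _) yz) _.
      rewrite !mulrA [_ * th j.+2]mulrC -[_ * _ * th j.+1]mulrA mth mulr1.
      by rewrite ler_pdivrMr// ler_peMr// ?ler1n// ltW.
    move: py; move: (p z) (p _) (_ * _) (th _) => b c d f; lra.
  exists (`|z|^-1 *: z); split; first exact: subspaceZ.
    by rewrite norml ?invr_gt0// mulVf// gt_eqF.
  rewrite /p (distortZ hc iotaN) -/p gtr0_norm ?invr_gt0// ler_pdivrMl//.
  apply: le_trans pz _; move: zge; move: (`|z|) (th _) => b c; lra.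
have py0 : 0 < p y.
  by apply: lt_le_trans (norm_le_distort hc iotaN j.+1 y); rewrite y1.
apply: (@le_trans _ _ (p x / p y)%:E); last by apply: ereal_sup_ubound; exists x, y.
rewrite lee_fin ler_pdivlMr//; apply: le_trans px.
rewrite ler_pdivlMr//; apply: le_trans mj.
apply: (@le_trans _ _ (lam * 12 * 12)).
  by rewrite ler_wpM2r// ler_wpM2l.
lra.
Qed.
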